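(* If hypothesis $H$ is true, then there is $\widehat q$ such that $r(n)=R_n$ a.s. There is convergence $\widehat Z_n-\widetilde Z_n\to 0$ a.s. (as $n\to\infty$), uniformly on $q$ in any segment in $(-1,\infty)$.
   Context: Hypothesis $H$: the words of a text are selected independently of each other from an infinite dictionary with the same discrete probability distribution, the word with number $i$ having probability $p_i=c(i+q)^{-\alpha}$, $i\ge 1$, where $\alpha=1/\theta$, $0<\theta<1$, $q>-1$, and $c=1/\zeta(\alpha,q+1)>0$ is the normalizing constant, with $\zeta(\alpha,x)=\sum_{i=0}^{\infty}(i+x)^{-\alpha}$ the Hurwitz zeta function. The number of words in the text is $n$; $R_k$ is the number of different words among the first $k$ words, and $R_0=0$. Estimator of $\theta$: $\widehat\theta=\int_0^1\log^+R_{[nt]}\,dA(t)$, where $\log^+x=\max(\log x,0)$, $[\cdot]$ is the integer part, and $A$ is a function on $[0,1]$ that is the sum of a step function and a piecewise continuously differentiable function, with $A(t)=0$ for $t\in[0,\delta]$ for some $\delta\in(0,1)$, $A(0)=A(+0)=A(1)=0$ and $\int_0^1\log t\,dA(t)=1$. For example, $A(t)=0$ on $[0,1/2]$, $A(t)=-1/\log 2$ on $(1/2,1)$, $A(1)=0$ gives $\widehat\theta=\log_2(R_n/R_{[n/2]})$, $n\ge 2$. Estimated probabilities: $\widehat p_i=\widehat c\,(i+\widehat q)^{-1/\widehat\theta}$, $i\ge 1$, where $\widehat c=1/\zeta(1/\widehat\theta,1+\widehat q)$ is the normalizing constant. Put $r(k)=\sum_{i=1}^{\infty}\left(1-(1-\widehat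 p_i)^k\right)$ for $0\le k\le n$. The value $\widehat q$ is such that $r(n)=R_n$. Processes on $[0,1]$: for $0\le k\le n$, $$\widehat Z_n(k/n)=\frac{R_k-(k/n)^{\widehat\theta}R_n}{\sqrt{R_n}},\qquad \widetilde Z_n(k/n)=\frac{R_k-r(k)}{\sqrt{R_n}},$$ with linear interpolation between the points $k/n$. The process $\widetilde Z_n$, obtained by substituting $r(k)$ for $(k/n)^{\widehat\theta}R_n$ in $\widehat Z_n$, is called the empirical bridge of the text. Convergence of processes is understood in the uniform metric on $[0,1]$.
   Formalization: Existence of q̂ with r(n)=R_n is stated almost surely for all sufficiently large n: for a fixed n≥2 it fails with positive probability, since R_n=n can occur while r(n)<n always (and for n=1 one has θ̂=0, so r is undefined). *)

(* Defs.v *)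
From HB Require Import structures.
From mathcomp Require Import all_boot all_order all_algebra.
From mathcomp Require Import all_classical all_reals all_analysis.
Set Implicit Arguments.
Unset Strict Implicit.
Unset Printing Implicit Defensive.
Import Order.TTheory GRing.Theory Num.Theory.
Import numFieldNormedType.Exports.
Local Open Scope classical_set_scope.
Local Open Scope ring_scope.

Definition hurwitz_zeta (R : realType) (alpha x : R) : R :=
  limn (series (fun i : nat => (i%:R + x) `^ (- alpha))).

Definition zipf_mandelbrot (R : realType) (theta q : R) (i : nat) : R :=
  (hurwitz_zeta theta^-1 (q + 1))^-1 * (i%:R + q) `^ (- theta^-1).

Definition mutually_independent (R : realType) (d d' : measure_display)
    (T : measurableType d) (T' : measurableType d') (P : probability T R)
    (X : nat -> {RV P >-> T'}) : Prop :=
  forall (s : seq nat) (B : nat -> set T'),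
    uniq s -> (forall j, measurable (B j)) ->
    P (\big[setI/setT]_(j <- s) (X j @^-1` B j)) =
    (\prod_(j <- s) P (X j @^-1` B j))%E.

(* [X j] is the number of the (j+1)-th word of the text.  Word numbers start
   at 1; the value 0 has probability zero because the probabilities of the
   words i >= 1 add up to 1. *)
Definition hypothesisH (R : realType) (d : measure_display)
    (T : measurableType d) (P : probability T R) (X : nat -> {RV P >-> nat})
    (theta q : R) : Prop :=
  [/\ 0 < theta < 1,
      -1 < q,
      forall j i : nat, (1 <= i)%N ->
        P (X j @^-1` [set i]) = (zipf_mandelbrot theta q i)%:E
    & mutually_independent X].

Definition nb_words (x : nat -> nat) (k : nat) : nat :=
  size (undup [seq x j | j <- iota 0 k]).

Definition step_function01 (R : realType) (S : R -> R) : Prop :=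
  exists2 s : seq R, itv_partition 0 1 s &
    forall i, (i < size s)%N ->
      exists c, {in `](0 :: s)`_i, s`_i[, forall t, S t = c}.

(* On each piece the function is the restriction of a C^1 function on the
   whole line, i.e. the derivative has finite one-sided limits at the
   endpoints.  Values and jumps at the endpoints of the pieces are free. *)
Definition piecewise_C1_01 (R : realType) (B : R -> R) : Prop :=
  exists2 s : seq R, itv_partition 0 1 s &
    forall i, (i < size s)%N ->
      exists g : R -> R,
        [/\ forall t, derivable g t 1,
            continuous (derive1 g)
          & {in `](0 :: s)`_i, s`_i[, B =1 g}].

Definition jump01 (R : realType) (A : R -> R) (t : R) : R :=
  (if t < 1 then lim (A x @[x --> t^'+]) else A t) -
  (if 0 < t then lim (A x @[x --> t^'-]) else A t).

(* The Lebesgue-Stieltjes integral of f over [0,1] with respect to dA, for A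
   the sum of a step function and a piecewise C^1 function: dA is then the sum
   of the point masses [jump01 A t] (nonzero at finitely many t) and of A'(t)dt.
   Only A on [0,1] matters: at 1 the right limit is read as A 1, and at 0 the
   left limit as A 0. *)
Definition stieltjes01 (R : realType) (A f : R -> R) : R :=
  \sum_(t \in `[0, 1]%classic) (f t * jump01 A t) +
  Rintegral lebesgue_measure `[0, 1] (fun t => f t * derive1 A t).

Definition admissible (R : realType) (A : R -> R) : Prop :=
  [/\ exists S B : R -> R, [/\ step_function01 S, piecewise_C1_01 B &
        {in `[0, 1], forall t, A t = S t + B t}],
      exists2 delta : R, 0 < delta < 1 & {in `[0, delta], forall t, A t = 0},
      [/\ A 0 = 0, A t @[t --> 0^'+] --> 0 & A 1 = 0]
    & stieltjes01 A (@ln R) = 1].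

(* log^+; [ln 0] is 0 in the library, so the value at 0 is 0 as it should. *)
Definition logp (R : realType) (x : R) : R := Num.max (ln x) 0.

Definition theta_hat (R : realType) (A : R -> R) (x : nat -> nat) (n : nat)
    : R :=
  stieltjes01 A (fun t => logp (nb_words x (Num.truncn (n%:R * t)))%:R).

(* r(k), for the probabilities with parameters [th] and [qh]. *)
Definition expected_words (R : realType) (th qh : R) (k : nat) : R :=
  limn (series (fun i : nat => 1 - (1 - zipf_mandelbrot th qh i.+1) ^+ k)).

(* [qh] is a value of the estimator of q: r(n) = R_n.  The estimated
   probabilities, hence r, only make sense when 0 < theta_hat < 1 (otherwise
   the zeta series diverges) and -1 < qh. *)
Definition is_q_hat (R : realType) (A : R -> R) (x : nat -> nat) (n : nat)
    (qh : R) : Prop :=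
  [/\ 0 < theta_hat A x n < 1,
      -1 < qh
    & expected_words (theta_hat A x n) qh n = (nb_words x n)%:R].

(* The function on [0,1] equal to [f k] at k/n and linear in between. *)
Definition interpolation (R : realType) (n : nat) (f : nat -> R) (t : R) : R :=
  let k := Num.truncn (n%:R * t) in
  f k + (n%:R * t - k%:R) * (f k.+1 - f k).

Definition Z_hat (R : realType) (A : R -> R) (x : nat -> nat) (n : nat)
    : R -> R :=
  interpolation n (fun k =>
    ((nb_words x k)%:R - (k%:R / n%:R) `^ (theta_hat A x n) * (nb_words x n)%:R)
    / Num.sqrt (nb_words x n)%:R).

Definition Z_tilde (R : realType) (A : R -> R) (x : nat -> nat) (n : nat)
    (qh : R) : R -> R :=
  interpolation n (fun k =>
    ((nb_words x k)%:R - expected_words (theta_hat A x n) qh k)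
    / Num.sqrt (nb_words x n)%:R).

Definition unif_dist01 (R : realType) (f g : R -> R) : R :=
  sup [set `|f t - g t| | t in `[0, 1]%classic].

(* Main.v *)
Require Import Defs.
From HB Require Import structures.
From mathcomp Require Import all_boot all_order all_algebra.
From mathcomp Require Import all_classical all_reals all_analysis.
From mathcomp Require Import measurable_realfun.
From mathcomp Require Import ring lra zify.
Set Implicit Arguments.
Unset Strict Implicit.
Unset Printing Implicit Defensive.
Import Order.TTheory GRing.Theory Num.Theory.
Import numFieldNormedType.Exports.
Local Open Scope classical_set_scope.
Local Open Scope ring_scope.

(** The two processes differ only by the comparison of r(k) with (k/n)^th r(n),
    where th is the estimated exponent and r(n) = R_n.  For every exponent th in
    (0,1) and every q > -1 the difference is at most 2q+7, uniformly in k <= n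
    ([expected_words_lin]).  The reason is scaling.  Up to the error
    sum_i p_i = 1, r(k) is the mean F(k) = sum_i (1 - exp (- k p_i)) for a text
    whose length is a Poisson variable ([expected_words_poisson]).  As p_i is a
    multiple of (i+q)^(-1/th), F(k) is the sum over i of g ((i+q) / k^th) for
    one decreasing function g with values in [0,1].  Shifting the argument by q
    costs q+2 ([series_shift_diff]), and for q = 0 the Riemann sums of g at two
    scales are proportional to the scales up to 1 ([scaled_sum_lin]).  Hence the
    uniform distance of the processes is at most (2 qh + 7) / sqrt R_n
    ([Z_dist_le]), qh being the estimate of q, and it remains to show that qh
    exists and that it is o(sqrt R_n).

    Existence: r(n) is continuous in q, since a change of q multiplies all p_i
    by factors close to 1 ([zipf_ratio]); it is close to 1 for q close to -1 and
    close to n for large q, so it takes every value 2, ..., n-1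
    ([expected_words_onto]).

    Size: put Q = qh + 1.  Lower bounds for r(n) that increase with Q become
    upper bounds for Q in terms of R_n = r(n): (1-th) n^th Q^(1-th) <= 2 R_n + Q
    if Q >= 1 ([q_hat_pow_le]), and Q <= 2 R_n / th if 2 R_n <= n
    ([q_hat_ge_lin]).  If R_n is of order n^theta and th is close enough to the
    true exponent theta, then Q = O(n^(theta/4)) ([q_hat_growth]), while
    sqrt R_n is of order n^(theta/2) ([good_of_counts]).

    The order of R_n comes from a strong law: R_k / E R_k tends to 1 almost
    surely, uniformly in q in a segment ([nb_words_strong_law]).  The events
    that given words have occurred are negatively correlated, so the variance of
    R_k is at most its mean.  Chebyshev's inequality is then summable along
    k = j^M for a suitable M, and the monotonicity of R_k and of E R_k fills the
    gaps.

    Consistency of the estimator of theta: by the first estimate, now with the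
    true parameters, log R_[nt] = log E R_n + theta log t + o(1) uniformly on
    [delta,1].  The measure dA is carried by [delta,1], has finite variation and
    total mass A(1) - A(0) = 0, and it integrates log t to 1, so the integral
    of log R_[nt] tends to theta ([stieltjes01_near], [theta_hat_consistent]).

    All conditions hold outside the exceptional event of the strong law, whose
    probability is bounded by constants depending on the segment only; this is
    the uniform statement ([bad_event_small]).  The almost sure statement is the
    case of a segment reduced to one point. *)

(** * Series with nonnegative terms *)

Lemma is_cvg_series_ub (R : realType) (u : R^nat) (M : R) :
  (forall i, 0 <= u i) -> (forall n, series u n <= M) -> cvgn (series u).
Proof.
move=> u0 uM; apply: nondecreasing_is_cvgn; first exact: nondecreasing_series.
by exists M => _ [n _ <-].
Qed.

Lemma lim_series_ub (R : realType) (u : R^nat) (M : R) :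
  cvgn (series u) -> (forall n, series u n <= M) -> limn (series u) <= M.
Proof. by move=> cu uM; apply: limr_le => //; exact: nearW. Qed.

Lemma series_le_lim (R : realType) (u : R^nat) n :
  (forall i, 0 <= u i) -> cvgn (series u) -> series u n <= limn (series u).
Proof.
by move=> u0 cu; apply: nondecreasing_cvgn_le => //; exact: nondecreasing_series.
Qed.

Lemma lim_series_ge0 (R : realType) (u : R^nat) :
  (forall i, 0 <= u i) -> cvgn (series u) -> 0 <= limn (series u).
Proof.
by move=> u0 cu; apply: le_trans (series_le_lim 0 u0 cu); rewrite /series/= big_geq.
Qed.

Lemma is_cvg_seriesMl (R : realType) (u : R^nat) (k : R) :
  cvgn (series u) -> cvgn (series (fun i => k * u i)).
Proof. by move=> cu; exact: (@is_cvg_seriesZ R u k cu). Qed.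

Lemma lim_seriesMl (R : realType) (u : R^nat) (k : R) :
  cvgn (series u) -> limn (series (fun i => k * u i)) = k * limn (series u).
Proof. by move=> cu; exact: (@lim_seriesZ R u k cu). Qed.

Lemma cvg_series_shift (R : realType) (u : R^nat) (l : R) :
  series (fun i => u i.+1) @ \oo --> l -> series u @ \oo --> u 0%N + l.
Proof.
move=> h; rewrite -cvg_shiftS.
have -> : (fun n => series u n.+1) = (fun n => u 0%N + series (fun i => u i.+1) n).
  by apply/funext => n; rewrite /series/= big_nat_recl.
by apply: cvgD => //; exact: cvg_cst.
Qed.

Lemma is_cvg_series_shift (R : realType) (u : R^nat) :
  cvgn (series u) -> cvgn (series (fun i => u i.+1)).
Proof.
move=> h; apply/cvg_ex; exists (limn (series u) - u 0%N).
have -> : series (fun i => u i.+1) = (fun n => series u n.+1 - u 0%N).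
  by apply/funext => n; rewrite /series/= big_nat_recl// addrC addKr.
by apply: cvgB; [rewrite (cvg_shiftS (series u)) | exact: cvg_cst].
Qed.

Lemma lim_series_recl (R : realType) (u : R^nat) :
  cvgn (series u) ->
  limn (series u) = u 0%N + limn (series (fun i => u i.+1)).
Proof.
move=> h; apply: cvg_lim => //; apply: cvg_series_shift.
exact: is_cvg_series_shift.
Qed.

(** * The Hurwitz zeta function *)

(** The terms of the zeta series are compared with the increments of x^(-b),
    which telescope.  This side follows from ln (1+1/x) >= 1/(x+1) and
    exp y >= 1+y. *)
Lemma powR_telescope_le (R : realType) (b x : R) : 0 < b -> 0 < x ->
  b * (x + 1) `^ (- (b + 1)) <= x `^ (- b) - (x + 1) `^ (- b).
Proof.
move=> b0 x0; have x10 : 0 < x + 1 by lra.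
rewrite opprD powRD ?(gt_eqF x10) ?implybT// (powR_inv1 (ltW x10)).
have -> : x `^ (- b) = (x + 1) `^ (- b) * expR (b * ln ((x + 1) / x)).
  rewrite /powR !gt_eqF// -expRD; congr expR.
  by rewrite ln_div ?posrE//; ring.
have h : 1 / (x + 1) <= ln ((x + 1) / x).
  have -> : (x + 1) / x = (1 - 1 / (x + 1))^-1 by field; lra.
  rewrite lnV ?posrE; last by rewrite subr_gt0 ltr_pdivrMr//; lra.
  rewrite lerNr; apply: le_ln1Dx; rewrite ltrN2 ltr_pdivrMr//; lra.
have := expR_ge1Dx (b * ln ((x + 1) / x)).
have := ler_wpM2l (ltW b0) h.
have := powR_gt0 (- b) x10; set p := _ `^ _; set e := expR _; set L := b * ln _.
move=> p0 hL he.
have h2 : p * (1 + b * (1 / (x + 1))) <= p * e by rewrite ler_pM2l//; lra.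
have -> : b * (p / (x + 1)) = p * (b * (1 / (x + 1))) by field; lra.
lra.
Qed.

(** The opposite comparison, from ln (1+1/x) <= 1/x. *)
Lemma powR_telescope_ge (R : realType) (b x : R) : 0 < b -> 0 < x ->
  x `^ (- b) - (x + 1) `^ (- b) <= b * x `^ (- (b + 1)).
Proof.
move=> b0 x0; have x10 : 0 < x + 1 by lra.
rewrite opprD powRD ?(gt_eqF x0) ?implybT// (powR_inv1 (ltW x0)).
have -> : (x + 1) `^ (- b) = x `^ (- b) * expR (- (b * ln (1 + 1 / x))).
  rewrite /powR !gt_eqF// -expRD; congr expR.
  have -> : 1 + 1 / x = (x + 1) / x by field; lra.
  by rewrite ln_div ?posrE//; ring.
have x1 : 0 < 1 / x by rewrite divr_gt0.
have h : ln (1 + 1 / x) <= 1 / x by apply: le_ln1Dx; lra.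
have := expR_ge1Dx (- (b * ln (1 + 1 / x))).
have := ler_wpM2l (ltW b0) h.
have := powR_gt0 (- b) x0; set p := _ `^ _; set e := expR _; set L := b * ln _.
move=> p0 hL he.
have h2 : p * (1 - b * (1 / x)) <= p * e by rewrite ler_pM2l//; lra.
have -> : b * (p / x) = p * (b * (1 / x)) by field; lra.
lra.
Qed.

Lemma powR_nonincr (R : realType) (a x y : R) : 0 <= a -> 0 < x -> x <= y ->
  y `^ (- a) <= x `^ (- a).
Proof.
move=> a0 x0 xy; rewrite !powRN lef_pV2 ?posrE ?powR_gt0//; last first.
  exact: lt_le_trans xy.
by apply: ge0_ler_powR => //; rewrite nnegrE; lra.
Qed.

(** The first term is kept apart because the telescoping bound controls the
    term at x+1 by the increment from x to x+1. *)
Lemma series_hurwitz_ub (R : realType) (a x : R) n : 1 < a -> 0 < x ->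
  series (fun i : nat => (i%:R + x) `^ (- a)) n <=
  x `^ (- a) + x `^ (- (a - 1)) / (a - 1).
Proof.
move=> a1 x0; have b0 : 0 < a - 1 by lra.
have pos i : 0 < i%:R + x :> R by apply: ltr_wpDl.
suff h m : (a - 1) * series (fun i : nat => (i%:R + x) `^ (- a)) m.+1 <=
    (a - 1) * x `^ (- a) + x `^ (- (a - 1)) - (m%:R + x) `^ (- (a - 1)).
  rewrite -(ler_pM2l b0) mulrDr (mulrC (a - 1) (_ / _)) divfK ?gt_eqF//.
  case: n => [|n].
    by rewrite /series/= big_geq// mulr0 addr_ge0// ?mulr_ge0 ?powR_ge0// ltW.
  by apply: le_trans (h n) _; rewrite gerBl powR_ge0.
elim: m => [|m ih].
  by rewrite /series/= big_nat1 add0r addrK.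
rewrite seriesSr mulrDr.
have := powR_telescope_le b0 (pos m).
rewrite subrK -natr1 -!addrA (addrC 1 x) !addrA.
by move: ih; lra.
Qed.

Lemma series_hurwitz_lb (R : realType) (a x : R) n : 1 < a -> 0 < x ->
  (x `^ (- (a - 1)) - (n%:R + x) `^ (- (a - 1))) / (a - 1) <=
  series (fun i : nat => (i%:R + x) `^ (- a)) n.
Proof.
move=> a1 x0; have b0 : 0 < a - 1 by lra.
have pos i : 0 < i%:R + x :> R by apply: ltr_wpDl.
rewrite ler_pdivrMr// mulrC.
elim: n => [|n ih]; first by rewrite /series/= big_geq// add0r subrr mulr0.
rewrite seriesSr mulrDr.
have := powR_telescope_ge b0 (pos n).
rewrite subrK -natr1 -!addrA (addrC 1 x) !addrA.
by move: ih; lra.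
Qed.

Lemma is_cvg_hurwitz (R : realType) (a x : R) : 1 < a -> 0 < x ->
  cvgn (series (fun i : nat => (i%:R + x) `^ (- a))).
Proof.
move=> a1 x0; apply: is_cvg_series_ub => [i|n]; first exact: powR_ge0.
exact: series_hurwitz_ub.
Qed.

(** With [hurwitz_ge], zeta(a,x) is x^(1-a)/(a-1) up to its first term. *)
Lemma hurwitz_le (R : realType) (a x : R) : 1 < a -> 0 < x ->
  hurwitz_zeta a x <= x `^ (- a) + x `^ (- (a - 1)) / (a - 1).
Proof.
move=> a1 x0; apply: lim_series_ub; first exact: is_cvg_hurwitz.
by move=> n; exact: series_hurwitz_ub.
Qed.

Lemma cvg_powRN_natD (R : realType) (b x : R) : 0 < b ->
  (n%:R + x) `^ (- b) @[n --> \oo] --> (0 : R).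
Proof.
move=> b0; apply/cvgrPdist_le => e e0; near=> n.
rewrite sub0r normrN ger0_norm ?powR_ge0//.
have np : e `^ (- b^-1) <= n%:R + x.
  by rewrite -lerBlDr; near: n; exact: nbhs_infty_ger.
have ep : 0 < e `^ (- b^-1) by exact: powR_gt0.
apply: le_trans (powR_nonincr (ltW b0) ep np) _.
by rewrite -powRrM mulrNN mulVf ?gt_eqF// powRr1// ltW.
Unshelve. all: by end_near. Qed.

Lemma hurwitz_ge (R : realType) (a x : R) : 1 < a -> 0 < x ->
  x `^ (- (a - 1)) / (a - 1) <= hurwitz_zeta a x.
Proof.
move=> a1 x0; have b0 : 0 < a - 1 by lra.
have h : (x `^ (- (a - 1)) - (n%:R + x) `^ (- (a - 1))) / (a - 1) @[n --> \oo]
    --> (x `^ (- (a - 1)) - 0) / (a - 1).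
  apply: cvgM; last exact: cvg_cst.
  by apply: cvgB; [exact: cvg_cst | exact: cvg_powRN_natD].
rewrite subr0 in h; rewrite -(cvg_lim _ h)//.
apply: ler_lim; [exact: cvgP h | exact: is_cvg_hurwitz |].
by apply: nearW => n; exact: series_hurwitz_lb.
Qed.

Lemma hurwitz_gt0 (R : realType) (a x : R) : 1 < a -> 0 < x ->
  0 < hurwitz_zeta a x.
Proof.
move=> a1 x0; apply: lt_le_trans (hurwitz_ge a1 x0).
by rewrite divr_gt0 ?powR_gt0//; lra.
Qed.

Lemma hurwitz_nonincr (R : realType) (a x y : R) : 1 < a -> 0 < x -> x <= y ->
  hurwitz_zeta a y <= hurwitz_zeta a x.
Proof.
move=> a1 x0 xy; apply: lim_series_le; try (apply: is_cvg_hurwitz => //; lra).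
move=> n; apply: powR_nonincr; [lra| |lra].
by apply: ltr_wpDl.
Qed.

(** * Riemann sums of a decreasing function at two scales *)

Lemma sum_nat_le_const (R : realType) (u : R^nat) (m n : nat) (c : R) :
  (forall i, (m <= i < m + n)%N -> u i <= c) ->
  \sum_(m <= i < m + n) u i <= n%:R * c.
Proof.
move=> h; apply: (le_trans (@ler_sum_nat _ _ _ _ (fun=> c) h)).
by rewrite sumr_const_nat addKn mulr_natl.
Qed.

Lemma sum_nat_ge_const (R : realType) (u : R^nat) (m n : nat) (c : R) :
  (forall i, (m <= i < m + n)%N -> c <= u i) ->
  n%:R * c <= \sum_(m <= i < m + n) u i.
Proof.
move=> h; apply: (le_trans _ (@ler_sum_nat _ _ _ (fun=> c) _ h)).
by rewrite sumr_const_nat addKn mulr_natl.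
Qed.

(** v times a Riemann sum of g over the half-line, with step 1/v. *)
Definition scaled_sum (R : realType) (g : R -> R) (v : R) : R :=
  limn (series (fun i => g (i.+1%:R / v))).

(** Group the terms at the fine scale into blocks of N.  Every term of a block
    other than the first is at most the last coarse term that precedes it; the
    first block has no such term and contributes at most N. *)
Lemma series_block_le (R : realType) (g : R -> R) (v : R) (N M : nat) :
  {in Num.pos &, {homo g : x y / x <= y >-> y <= x}} ->
  (forall x, 0 < x -> g x <= 1) -> 0 < v -> (0 < N)%N ->
  series (fun i => g (i.+1%:R / (N%:R * v))) (N * M.+1)%N <=
  N%:R + N%:R * series (fun i => g (i.+1%:R / v)) M.
Proof.
move=> gd g1 v0 N0.
have Nv0 : 0 < N%:R * v by rewrite mulr_gt0 ?ltr0n.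
elim: M => [|M ih].
  rewrite /series/= [X in _ <= _ + _ * X]big_geq// mulr0 addr0 muln1.
  apply: (le_trans (@sum_nat_le_const _ _ 0 N 1 _)); last by rewrite mulr1.
  by move=> i _; apply: g1; rewrite divr_gt0 ?ltr0n.
rewrite mulnS series_addn [X in \sum_(_ <= _ < X) _]addnC seriesSr mulrDr addrA.
apply: lerD => //; apply: sum_nat_le_const => i /andP[iM _].
apply: gd; rewrite ?posrE ?divr_gt0 ?ltr0n//.
rewrite invfM mulrA ler_pM2r ?invr_gt0// ler_pdivlMr ?ltr0n//.
by rewrite -natrM ler_nat mulnC leqW.
Qed.

Lemma series_block_ge (R : realType) (g : R -> R) (v : R) (N M : nat) :
  {in Num.pos &, {homo g : x y / x <= y >-> y <= x}} -> 0 < v -> (0 < N)%N ->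
  N%:R * series (fun i => g (i.+1%:R / v)) M <=
  series (fun i => g (i.+1%:R / (N%:R * v))) (N * M)%N.
Proof.
move=> gd v0 N0.
have Nv0 : 0 < N%:R * v by rewrite mulr_gt0 ?ltr0n.
elim: M => [|M ih]; first by rewrite muln0 /series/= !big_geq// mulr0.
rewrite mulnS series_addn [X in \sum_(_ <= _ < X) _]addnC seriesSr mulrDr.
apply: lerD => //; apply: sum_nat_ge_const => i /andP[_ iM].
apply: gd; rewrite ?posrE ?divr_gt0 ?ltr0n//.
rewrite invfM mulrA ler_pM2r ?invr_gt0// ler_pdivrMr ?ltr0n//.
by rewrite -natrM ler_nat mulSn mulnC addnC.
Qed.

Lemma cvg_subseq_muln (R : realType) (u : R^nat) (N : nat) : (0 < N)%N ->
  cvgn u -> (fun M => u (N * M)%N) @ \oo --> limn u.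
Proof.
move=> N0 cu; apply: (cvg_comp _ _ _ cu).
apply/cvgnyPge => A; near=> n.
have : (A <= n)%N by near: n; exact: nbhs_infty_ge.
by move=> An; rewrite (leq_trans An)// leq_pmull.
Unshelve. all: by end_near. Qed.

(** Multiplying the scale by an integer N multiplies the sum by N up to an error
    of N, by comparing blocks of N fine terms with one coarse term. *)
Lemma scaled_sum_muln (R : realType) (g : R -> R) (v : R) (N : nat) :
  {in Num.pos &, {homo g : x y / x <= y >-> y <= x}} ->
  (forall x, 0 < x -> g x <= 1) ->
  (forall v, 0 < v -> cvgn (series (fun i => g (i.+1%:R / v)))) ->
  0 < v -> (0 < N)%N ->
  N%:R * scaled_sum g v <= scaled_sum g (N%:R * v) <= N%:R + N%:R * scaled_sum g v.
Proof.
move=> gd g1 gc v0 N0.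
have Nv0 : 0 < N%:R * v by rewrite mulr_gt0 ?ltr0n.
have c1 := cvg_subseq_muln N0 (gc _ Nv0).
have c2 := gc _ v0.
have c3 : (N%:R * series (fun i => g (i.+1%:R / v)) M) @[M --> \oo] -->
    N%:R * scaled_sum g v by apply: cvgM => //; exact: cvg_cst.
rewrite /(scaled_sum _ (_ * _)) -(cvg_lim _ c1)//; apply/andP; split.
  rewrite -(cvg_lim _ c3)//; apply: ler_lim; [exact: cvgP c3|exact: cvgP c1|].
  by apply: nearW => M; exact: series_block_ge.
have c4 : (N%:R + N%:R * series (fun i => g (i.+1%:R / v)) M) @[M --> \oo] -->
    N%:R + N%:R * scaled_sum g v by apply: cvgD => //; exact: cvg_cst.
have c5 : (fun M => series (fun i => g (i.+1%:R / (N%:R * v))) (N * M.+1)%N)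
    @ \oo --> limn (series (fun i => g (i.+1%:R / (N%:R * v)))).
  by rewrite (cvg_shiftS (fun M => series _ (N * M)%N)).
rewrite (cvg_lim _ c1)// -(cvg_lim _ c4)// -(cvg_lim _ c5)//.
apply: ler_lim; [exact: cvgP c5|exact: cvgP c4|].
by apply: nearW => M; exact: series_block_le.
Qed.

Lemma scaled_sum_le (R : realType) (g : R -> R) (v w : R) :
  {in Num.pos &, {homo g : x y / x <= y >-> y <= x}} ->
  (forall v, 0 < v -> cvgn (series (fun i => g (i.+1%:R / v)))) ->
  0 < v -> v <= w -> scaled_sum g v <= scaled_sum g w.
Proof.
move=> gd gc v0 vw; have w0 := lt_le_trans v0 vw.
apply: lim_series_le; [exact: gc|exact: gc|] => n.
apply: gd; rewrite ?posrE ?divr_gt0 ?ltr0n//.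
by rewrite ler_pM2l ?ltr0n// lef_pV2.
Qed.

Lemma ler_addgt0_nat (R : realType) (x y C : R) : 0 <= C ->
  (forall N, (0 < N)%N -> x <= y + C / N%:R) -> x <= y.
Proof.
move=> C0 h; apply/ler_addgt0Pr => e e0.
have := h (Num.truncn (C / e)).+1 isT; move/le_trans; apply.
rewrite lerD2l ler_pdivrMr ?ltr0n// mulrC -ler_pdivrMr//.
exact/ltW/truncnS_gt.
Qed.

(** Writing H(v) for the sum at scale v, N H(v) is H(N v) up to N, and H(N v) is
    caught between the integer scales a next to N v, where H(a) is a H(1) up to
    a.  Dividing by N and letting N grow leaves |H(v) - v H(1)| <= 1. *)
Lemma scaled_sum_lin (R : realType) (g : R -> R) (v : R) :
  {in Num.pos &, {homo g : x y / x <= y >-> y <= x}} ->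
  (forall x, 0 < x -> 0 <= g x <= 1) ->
  (forall v, 0 < v -> cvgn (series (fun i => g (i.+1%:R / v)))) ->
  0 < v <= 1 -> `|scaled_sum g v - v * scaled_sum g 1| <= 1.
Proof.
move=> gd g01 gc /andP[v0 v1].
have g1 x : 0 < x -> g x <= 1 by move=> /g01/andP[].
have g0 x : 0 < x -> 0 <= g x by move=> /g01/andP[].
have S0 : 0 <= scaled_sum g 1.
  apply: lim_series_ge0; last exact: gc.
  by move=> i; apply: g0; rewrite divr_gt0 ?ltr0n.
set S := scaled_sum g 1 in S0 *.
suff : v * S - 1 <= scaled_sum g v <= v * S + 1 by rewrite ler_distl.
apply/andP; split.
- apply: (@ler_addgt0_nat _ _ _ S) => // N N0.
  have N0' : 0 < N%:R :> R by rewrite ltr0n.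
  have /andP[_] := scaled_sum_muln gd g1 gc v0 N0.
  set a := Num.truncn (v * N%:R).
  have va : v * N%:R < a%:R + 1 by rewrite natr1; exact: truncnS_gt.
  have av : a%:R <= v * N%:R by rewrite truncn_le mulr_ge0// ltW.
  have aS : a%:R * S <= scaled_sum g (N%:R * v).
    have [->|a0] := posnP a.
      rewrite mul0r; apply: lim_series_ge0; last by apply: gc; rewrite mulr_gt0.
      by move=> i; apply: g0; rewrite divr_gt0 ?ltr0n ?mulr_gt0.
    have /andP[+ _] := scaled_sum_muln gd g1 gc ltr01 a0.
    move/le_trans; apply; rewrite mulr1.
    by apply: scaled_sum_le => //; rewrite ?ltr0n// mulrC.
  move=> h; rewrite lerBlDr addrAC -lerBlDr.
  rewrite -(ler_pM2l N0') mulrBr mulrDr mulr1 mulrA [N%:R * v]mulrC.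
  rewrite [_ * (S / _)]mulrC divfK ?gt_eqF//.
  have := ler_wpM2r S0 (ltW va); lra.
- apply: (@ler_addgt0_nat _ _ _ (S + 1)); first by rewrite addr_ge0.
  move=> N N0; have N0' : 0 < N%:R :> R by rewrite ltr0n.
  have /andP[+ _] := scaled_sum_muln gd g1 gc v0 N0.
  set a := (Num.truncn (v * N%:R)).+1.
  have va : v * N%:R <= a%:R by exact/ltW/truncnS_gt.
  have av : a%:R <= v * N%:R + 1.
    by rewrite /a -natr1 lerD2r truncn_le mulr_ge0// ltW.
  have aS : scaled_sum g (N%:R * v) <= a%:R + a%:R * S.
    have /andP[_] := scaled_sum_muln gd g1 gc ltr01 (isT : 0 < a)%N.
    apply: le_trans; rewrite mulr1.
    by apply: scaled_sum_le; rewrite ?mulr_gt0// mulrC.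
  move=> h; rewrite -(ler_pM2l N0') !mulrDr mulr1 mulrA [N%:R * v]mulrC.
  rewrite [N%:R * (_ / _)]mulrC divfK ?gt_eqF//.
  have := ler_wpM2r S0 av.
  have : v * N%:R <= N%:R by rewrite ler_piMl// ltW.
  move: h aS av; lra.
Qed.

(** * The expected number of different words and its scaling *)

Lemma zipfE (R : realType) (th q : R) (i : nat) :
  zipf_mandelbrot th q i.+1 =
  (hurwitz_zeta th^-1 (q + 1))^-1 * (i%:R + (q + 1)) `^ (- th^-1).
Proof. by rewrite /zipf_mandelbrot -natr1 -addrA (addrC 1 q). Qed.

Lemma is_cvg_zipf (R : realType) (th q : R) : 0 < th < 1 -> -1 < q ->
  cvgn (series (fun i => zipf_mandelbrot th q i.+1)).
Proof.
move=> /andP[th0 th1] q1; under eq_fun do rewrite zipfE.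
apply: is_cvg_seriesMl; apply: is_cvg_hurwitz; last by lra.
by rewrite invf_gt1.
Qed.

Lemma zipf_ge0 (R : realType) (th q : R) (i : nat) : 0 < th < 1 -> -1 < q ->
  0 <= zipf_mandelbrot th q i.+1.
Proof.
move=> /andP[th0 th1] q1; rewrite zipfE mulr_ge0 ?powR_ge0// invr_ge0 ltW//.
by apply: hurwitz_gt0; [rewrite invf_gt1|lra].
Qed.

Lemma lim_zipf (R : realType) (th q : R) : 0 < th < 1 -> -1 < q ->
  limn (series (fun i => zipf_mandelbrot th q i.+1)) = 1.
Proof.
move=> /andP[th0 th1] q1; under eq_fun do rewrite zipfE.
have th1' : 1 < th^-1 by rewrite invf_gt1.
rewrite lim_seriesMl; last by apply: is_cvg_hurwitz => //; lra.
by rewrite mulVf// gt_eqF// hurwitz_gt0//; lra.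
Qed.

Lemma zipf_le1 (R : realType) (th q : R) (i : nat) : 0 < th < 1 -> -1 < q ->
  zipf_mandelbrot th q i.+1 <= 1.
Proof.
move=> h q1; rewrite -(lim_zipf h q1).
apply: le_trans (series_le_lim i.+1 _ (is_cvg_zipf h q1)); last first.
  by move=> j; exact: zipf_ge0.
rewrite seriesSr lerDr; apply: sumr_ge0 => j _; exact: zipf_ge0.
Qed.

Lemma zipf_le_first (R : realType) (th q : R) (i : nat) :
  0 < th < 1 -> -1 < q ->
  zipf_mandelbrot th q i.+1 <= zipf_mandelbrot th q 1.
Proof.
move=> /andP[th0 th1] q1; rewrite !zipfE ler_wpM2l//.
  by rewrite invr_ge0 ltW// hurwitz_gt0 ?invf_gt1//; lra.
apply: powR_nonincr; [by rewrite invr_ge0 ltW|lra|].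
by rewrite lerD2r ler0n.
Qed.

(** Replacing (1-p)^k by exp (- k p) costs at most p, whatever k is.  For k = 1
    put a = exp (- p); then a - (1-p) <= p (1-a) says (1+p) exp (- p) <= 1.
    The stronger form a^k - (1-p)^k <= p (1 - a^k) passes from k to k+1. *)
Lemma exprN_sub_onem (R : realType) (p : R) (k : nat) : 0 <= p <= 1 ->
  (1 - p) ^+ k <= expR (- (k%:R * p)) <= (1 - p) ^+ k + p.
Proof.
move=> /andP[p0 p1].
rewrite -mulrN expRM_natl; set a := expR (- p).
have a0 : 0 < a by exact: expR_gt0.
have a1 : a <= 1 by rewrite expR_le1; lra.
have ba : 1 - p <= a by apply: expR_ge1Dx.
have ab : a - (1 - p) <= p * (1 - a).
  have h := expR_ge1Dx p.
  have : a * (1 + p) <= 1.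
    by rewrite /a -[leRHS](expRxMexpNx_1 p) mulrC ler_pM2r ?expR_gt0.
  lra.
apply/andP; split; first by apply: lerXn2r; rewrite ?nnegrE; lra.
suff h : a ^+ k - (1 - p) ^+ k <= p * (1 - a ^+ k).
  have := exprn_ge0 k (ltW a0); move: h; nra.
elim: k => [|k ih]; first by rewrite !expr0 !subrr mulr0.
have b0 : 0 <= (1 - p) ^+ k by apply: exprn_ge0; lra.
have b1 : (1 - p) ^+ k <= 1 by apply: exprn_ile1; lra.
rewrite !exprS.
have h1 := ler_wpM2l (ltW a0) ih.
have h2 : (1 - p) ^+ k * (a - (1 - p)) <= p * (1 - a).
  apply: le_trans ab; rewrite ler_piMl//; lra.
nra.
Qed.

Lemma onem_expr_le (R : realType) (p : R) (k : nat) : 0 <= p <= 1 ->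
  0 <= 1 - (1 - p) ^+ k <= k%:R * p.
Proof.
move=> /andP[p0 p1]; apply/andP; split.
  by rewrite subr_ge0 exprn_ile1//; lra.
elim: k => [|k ih]; first by rewrite expr0 subrr mul0r.
rewrite exprS -natr1.
have : (1 - p) ^+ k <= 1 by apply: exprn_ile1; lra.
have : 0 <= (1 - p) ^+ k by apply: exprn_ge0; lra.
nra.
Qed.

Lemma is_cvg_expected_words (R : realType) (th q : R) (k : nat) :
  0 < th < 1 -> -1 < q ->
  cvgn (series (fun i : nat => 1 - (1 - zipf_mandelbrot th q i.+1) ^+ k)).
Proof.
move=> h q1.
have p01 i : 0 <= zipf_mandelbrot th q i.+1 <= 1 by rewrite zipf_ge0 ?zipf_le1.
apply: (@series_le_cvg _ _ (fun i => k%:R * zipf_mandelbrot th q i.+1)).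
- by move=> i; case/andP: (onem_expr_le k (p01 i)).
- by move=> i; rewrite mulr_ge0 ?zipf_ge0.
- by move=> i; case/andP: (onem_expr_le k (p01 i)).
- exact/is_cvg_seriesMl/is_cvg_zipf.
Qed.

(** The expected number of different words in a text whose length is a Poisson
    variable with mean s.  Unlike [expected_words], it is defined for every real
    s >= 0 and depends on s through s p_i only, which gives the exact scaling. *)
Definition poisson_words (R : realType) (th q s : R) : R :=
  limn (series (fun i : nat => 1 - expR (- (s * zipf_mandelbrot th q i.+1)))).

Lemma onem_expRN_ge0 (R : realType) (x : R) : 0 <= x -> 0 <= 1 - expR (- x) <= x.
Proof.
move=> x0; rewrite subr_ge0 expR_le1 oppr_le0 x0/=.
by have := expR_ge1Dx (- x); lra.
Qed.

Lemma is_cvg_poisson_words (R : realType) (th q s : R) :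
  0 < th < 1 -> -1 < q -> 0 <= s ->
  cvgn (series (fun i : nat => 1 - expR (- (s * zipf_mandelbrot th q i.+1)))).
Proof.
move=> h q1 s0.
have sp0 i : 0 <= s * zipf_mandelbrot th q i.+1 by rewrite mulr_ge0 ?zipf_ge0.
apply: (@series_le_cvg _ _ (fun i => s * zipf_mandelbrot th q i.+1)) => //.
- by move=> i; case/andP: (onem_expRN_ge0 (sp0 i)).
- by move=> i; case/andP: (onem_expRN_ge0 (sp0 i)).
- exact/is_cvg_seriesMl/is_cvg_zipf.
Qed.

(** The i-th terms differ by at most p_i, and the p_i add up to 1. *)
Lemma expected_words_poisson (R : realType) (th q : R) (k : nat) :
  0 < th < 1 -> -1 < q ->
  `|expected_words th q k - poisson_words th q k%:R| <= 1.
Proof.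
move=> h q1.
have c1 := @is_cvg_expected_words _ _ _ k h q1.
have c2 := is_cvg_poisson_words h q1 (ler0n _ k).
have c3 := is_cvg_zipf h q1.
have p01 i : 0 <= zipf_mandelbrot th q i.+1 <= 1 by rewrite zipf_ge0 ?zipf_le1.
suff : poisson_words th q k%:R <= expected_words th q k <= poisson_words th q k%:R + 1.
  by move=> ?; rewrite ler_norml; lra.
apply/andP; split; first apply: lim_series_le => // i.
  by case/andP: (exprN_sub_onem k (p01 i)) => *; rewrite lerD2l lerN2.
rewrite -[X in _ + X](lim_zipf h q1) -lim_seriesD//; apply: lim_series_le => //.
  exact: is_cvg_seriesD.
move=> i; case/andP: (exprN_sub_onem k (p01 i)) => _ /= ?.
by rewrite [leRHS]/GRing.add/=; lra.
Qed.

(** Compare term by term after dropping the first floor(x) terms of the sum over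
    the integers, or the first term of the shifted sum. *)
Lemma series_shift_diff (R : realType) (f : R -> R) (x : R) : 0 < x ->
  {in Num.pos &, {homo f : x y / x <= y >-> y <= x}} ->
  (forall x, 0 < x -> 0 <= f x <= 1) ->
  cvgn (series (fun i => f i.+1%:R)) ->
  cvgn (series (fun i => f (i%:R + x))) ->
  `|limn (series (fun i => f (i%:R + x))) - limn (series (fun i => f i.+1%:R))|
    <= x + 1.
Proof.
move=> x0 fd f01 c1 c2.
have f1 y : 0 < y -> f y <= 1 by move=> /f01/andP[].
have f0 y : 0 < y -> 0 <= f y by move=> /f01/andP[].
have px i : 0 < i%:R + x by apply: ltr_wpDl.
set A := limn _; set B := limn _.
suff : B - x <= A <= B + 1 by move=> ?; rewrite ler_norml; lra.
apply/andP; split.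
  rewrite lerBlDr; apply: lim_series_ub => // n.
  pose m := Num.truncn x.
  have mx : m%:R <= x by rewrite truncn_le ltW.
  have xm : x <= m.+1%:R by exact/ltW/truncnS_gt.
  apply: (@le_trans _ _ (series (fun i => f i.+1%:R) (n + m)%N)).
    apply: nondecreasing_series; last exact: leq_addr.
    by move=> i _ _; apply: f0; rewrite ltr0n.
  rewrite series_addn addrC; apply: lerD; last first.
    apply: le_trans mx; rewrite -(mulr1 m%:R).
    apply: (@sum_nat_le_const _ _ 0%N m) => i _.
    by apply: f1; rewrite ltr0n.
  apply: le_trans (series_le_lim n _ c2); last by move=> i; exact: f0.
  rewrite -{1}(add0n m) big_addn addnK ler_sum_nat// => i _.
  apply: fd; rewrite ?posrE ?ltr0n//.
  by rewrite -addnS natrD lerD2l.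
rewrite /A lim_series_recl// addrC; apply: lerD; last exact: f1.
apply: lim_series_le => //; first exact: is_cvg_series_shift c2.
move=> i; apply: fd; rewrite ?posrE ?ltr0n ?px//; lra.
Qed.

(** As p_i = c (i+q)^(-1/th), the mean length s v^(1/th) has the same effect as
    dividing i+q by v.  So the claim is [scaled_sum_lin] for the sums over the
    integers, and the shift by q+1 costs q+2 on either side, by
    [series_shift_diff]: 1 + 2 (q+2) = 2q+5. *)
Lemma poisson_words_lin (R : realType) (th q s v : R) :
  0 < th < 1 -> -1 < q -> 0 <= s -> 0 < v <= 1 ->
  `|poisson_words th q (s * v `^ th^-1) - v * poisson_words th q s| <= 2 * q + 5.
Proof.
move=> h q1 s0 /andP[v0 v1]; have /andP[th0 th1] := h.
have al0 : 0 < th^-1 by rewrite invr_gt0.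
have al1 : 1 < th^-1 by rewrite invf_gt1.
set c := (hurwitz_zeta th^-1 (q + 1))^-1.
have c0 : 0 < c by rewrite invr_gt0 hurwitz_gt0//; lra.
pose g s x := 1 - expR (- (s * (c * x `^ (- th^-1)))) : R.
have gd t : 0 <= t -> {in Num.pos &, {homo g t : x y / x <= y >-> y <= x}}.
  move=> t0 x y; rewrite !posrE => x0 y0 xy.
  rewrite lerD2l lerN2 ler_expR lerN2 ler_wpM2l// ler_wpM2l ?(ltW c0)//.
  by apply: powR_nonincr => //; exact: ltW.
have g01 t x : 0 <= t -> 0 <= g t x <= t * (c * x `^ (- th^-1)).
  by move=> t0; apply: onem_expRN_ge0; rewrite !mulr_ge0 ?powR_ge0// ltW.
have g1 t x : g t x <= 1 by rewrite gerBl expR_ge0.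
have gc t x : 0 <= t -> 0 < x -> cvgn (series (fun i => g t (i%:R + x))).
  move=> t0 x0.
  apply: (@series_le_cvg _ _ (fun i => (t * c) * (i%:R + x) `^ (- th^-1))).
  - by move=> i; case/andP: (g01 t (i%:R + x) t0).
  - by move=> i; rewrite !mulr_ge0 ?powR_ge0// ltW.
  - by move=> i; case/andP: (g01 t (i%:R + x) t0); rewrite mulrA.
  - by apply: is_cvg_seriesMl; exact: is_cvg_hurwitz.
have gc1 t : 0 <= t -> cvgn (series (fun i => g t i.+1%:R)).
  move=> t0; have -> : (fun i => g t i.+1%:R) = (fun i => g t (i%:R + 1)).
    by apply/funext => i; rewrite natr1.
  exact: gc.
have gM t x w : 0 < w -> 0 < x -> g t (x / w) = g (t * w `^ th^-1) x.
  move=> w0 x0; rewrite /g; congr (1 - expR (- _)).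
  rewrite powRM ?ltW ?invr_gt0//.
  by rewrite -[w^-1]powR_inv1 ?(ltW w0)// -powRrM mulN1r opprK; ring.
have SE w : 0 < w ->
    (fun i => g s (i.+1%:R / w)) = (fun i => g (s * w `^ th^-1) i.+1%:R).
  by move=> w0; apply/funext => i; rewrite gM// ltr0n.
have gc2 w : 0 < w -> cvgn (series (fun i => g s (i.+1%:R / w))).
  by move=> w0; rewrite SE//; apply: gc1; rewrite mulr_ge0// powR_ge0.
have g01' t x : 0 <= t -> 0 < x -> 0 <= g t x <= 1.
  by move=> t0 x0; rewrite g1 andbT; case/andP: (g01 t x t0).
have := @scaled_sum_lin R (g s) v (gd s s0) (fun x => @g01' s x s0) gc2.
rewrite v0 v1 => /(_ isT).
have [B BE] : exists B, forall t, B t = limn (series (fun i => g t i.+1%:R)).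
  by eexists.
have SS w : 0 < w -> scaled_sum (g s) w = B (s * w `^ th^-1).
  by move=> w0; rewrite BE -(SE _ w0).
have s1 : s * 1 `^ th^-1 = s by rewrite powR1 mulr1.
rewrite (SS _ v0) (SS _ ltr01) s1.
have FE t : poisson_words th q t = limn (series (fun i => g t (i%:R + (q + 1)))).
  have <- : (fun i => 1 - expR (- (t * zipf_mandelbrot th q i.+1))) =
      (fun i => g t (i%:R + (q + 1))) by apply/funext => i; rewrite zipfE.
  by [].
have q0 : 0 < q + 1 by lra.
have sv0 : 0 <= s * v `^ th^-1 by rewrite mulr_ge0// powR_ge0.
have d t : 0 <= t -> `|poisson_words th q t - B t| <= q + 1 + 1.
  move=> t0; rewrite FE BE.
  apply: (@series_shift_diff R (g t) (q + 1)).
  + exact: q0.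
  + exact: gd.
  + by move=> x; exact: g01'.
  + exact: gc1.
  + exact: gc.
have := d _ s0; have := d _ sv0.
move: (poisson_words _ _ _) (poisson_words _ _ _) (B _) (B _) => a a' b b'.
rewrite !ler_norml => /andP[h1 h2] /andP[h3 h4] /andP[h5 h6].
have h7 : 0 <= v * (a' - b' + (q + 1 + 1)) by rewrite mulr_ge0 ?(ltW v0)//; lra.
have h8 : 0 <= v * ((q + 1 + 1) - (a' - b')) by rewrite mulr_ge0 ?(ltW v0)//; lra.
have h9 : v * (q + 1 + 1) <= q + 1 + 1 by rewrite ler_piMl//; lra.
apply/andP; split; nra.
Qed.

Lemma expected_words0 (R : realType) (th q : R) : expected_words th q 0 = 0.
Proof.
rewrite /expected_words; under eq_fun do rewrite expr0 subrr.
apply: cvg_lim => //.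
rewrite (_ : series _ = fun=> 0); first exact: cvg_cst.
by apply/funext => n; rewrite /series/= big1.
Qed.

(** The main estimate: for fixed parameters, the expected number of words
    follows the power law k^th up to a constant.  The exponent may be any number
    in (0,1) and the constant does not depend on it, so the estimate applies to
    the estimated parameters as well as to the true ones. *)
Lemma expected_words_lin (R : realType) (th q : R) (k n : nat) :
  0 < th < 1 -> -1 < q -> (k <= n)%N -> (0 < n)%N ->
  `|expected_words th q k - (k%:R / n%:R) `^ th * expected_words th q n|
    <= 2 * q + 7.
Proof.
move=> h q1 kn n0; have /andP[th0 th1] := h.
have [->|k0] := posnP k.
  by rewrite expected_words0 mul0r powR0 ?gt_eqF// mul0r subrr normr0; lra.
have n0' : 0 < n%:R :> R by rewrite ltr0n.
have kn0 : 0 < k%:R / n%:R :> R by rewrite divr_gt0// ltr0n.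
have kn1 : k%:R / n%:R <= 1 :> R by rewrite ler_pdivrMr// mul1r ler_nat.
set v := (_ / _) `^ th.
have v0 : 0 < v by exact: powR_gt0.
have v1 : v <= 1.
  have -> : 1 = 1 `^ th by rewrite powR1.
  by apply: ge0_ler_powR; rewrite ?nnegrE// ltW.
have := @poisson_words_lin R th q n%:R v h q1 (ltW n0').
rewrite v0 v1 => /(_ isT).
have -> : n%:R * v `^ th^-1 = k%:R.
  rewrite /v -powRrM mulfV ?gt_eqF// powRr1; last exact: ltW.
  by rewrite mulrC divfK ?gt_eqF.
have := expected_words_poisson k h q1; have := expected_words_poisson n h q1.
move: (expected_words _ _ _) (expected_words _ _ _) => a b.
move: (poisson_words _ _ _) (poisson_words _ _ _) => a' b'.
rewrite !ler_norml => /andP[h1 h2] /andP[h3 h4] /andP[h5 h6].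
have h7 : 0 <= v * (a - a' + 1) by rewrite mulr_ge0 ?(ltW v0)//; lra.
have h8 : 0 <= v * (1 - (a - a')) by rewrite mulr_ge0 ?(ltW v0)//; lra.
apply/andP; split; nra.
Qed.

(** * Bounds on the expected number of different words *)

(** From (1-p)^k <= exp (- k p) and exp (- x) <= 1/(1+x). *)
Lemma onem_expr_ge (R : realType) (p : R) (k : nat) : 0 <= p <= 1 ->
  k%:R * p / (1 + k%:R * p) <= 1 - (1 - p) ^+ k.
Proof.
move=> p01; have /andP[p0 _] := p01; have /andP[+ _] := exprN_sub_onem k p01.
have x0 : 0 <= k%:R * p by rewrite mulr_ge0.
set x := k%:R * p in x0 * => h.
have x1 : 0 < 1 + x by lra.
have : expR (- x) <= 1 - x / (1 + x).
  have -> : 1 - x / (1 + x) = (1 + x)^-1 by field; lra.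
  by rewrite expRN lef_pV2 ?posrE ?expR_gt0// expR_ge1Dx.
lra.
Qed.

(** In [onem_expr_ge] bound the denominators by the one of the largest
    probability p_1, then sum: the numerators add up to n. *)
Lemma expected_words_ge (R : realType) (th q : R) (n : nat) :
  0 < th < 1 -> -1 < q ->
  n%:R / (1 + n%:R * zipf_mandelbrot th q 1) <= expected_words th q n.
Proof.
move=> h q1.
have c1 := @is_cvg_expected_words _ _ _ n h q1.
have c3 := is_cvg_zipf h q1.
have p0 i := @zipf_ge0 _ _ _ i h q1.
have n0 : 0 <= n%:R :> R by [].
set D := 1 + _.
have D0 : 0 < D by apply: ltr_wpDr => //; apply: mulr_ge0 => //; exact: (p0 0%N).
have <- : limn (series (fun i => n%:R / D * zipf_mandelbrot th q i.+1)) = n%:R / D.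
  by rewrite lim_seriesMl// lim_zipf// mulr1.
apply: lim_series_le => //; first exact: is_cvg_seriesMl.
move=> i; apply: le_trans (onem_expr_ge n _); last by rewrite p0 zipf_le1.
rewrite mulrAC; apply: ler_wpM2l; first by rewrite mulr_ge0.
rewrite lef_pV2 ?posrE//; first by rewrite lerD2l ler_wpM2l// zipf_le_first.
by apply: ltr_wpDr => //; apply: mulr_ge0.
Qed.

(** Large q spreads the distribution: p_1 = Q^(-1/th) / zeta(1/th,Q) with
    Q = q+1, and zeta(1/th,Q) is at least Q^(1-1/th) / (1/th-1). *)
Lemma zipf_first_le (R : realType) (th q : R) : 0 < th < 1 -> -1 < q ->
  zipf_mandelbrot th q 1 <= (th^-1 - 1) / (q + 1).
Proof.
move=> /andP[th0 th1] q1.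
have al1 : 1 < th^-1 by rewrite invf_gt1.
have q0 : 0 < q + 1 by lra.
have b0 : 0 < th^-1 - 1 by lra.
rewrite zipfE add0r.
have -> : (th^-1 - 1) / (q + 1) =
    ((q + 1) `^ (- (th^-1 - 1)) / (th^-1 - 1))^-1 * (q + 1) `^ (- th^-1).
  have -> : - th^-1 = - (th^-1 - 1) + (-1) by ring.
  rewrite (@powRD _ _ _ (-1)) ?(gt_eqF q0) ?implybT// (powR_inv1 (ltW q0)).
  have := powR_gt0 (- (th^-1 - 1)) q0; set z := _ `^ _ => z0.
  rewrite invf_div.
  by field; rewrite !gt_eqF.
apply: ler_wpM2r; first exact: powR_ge0.
rewrite lef_pV2 ?posrE ?hurwitz_gt0//; first exact: hurwitz_ge.
by rewrite divr_gt0 ?powR_gt0.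
Qed.

Lemma expected_words_ge_q (R : realType) (th q : R) (n : nat) :
  0 < th < 1 -> -1 < q ->
  n%:R * (q + 1) <= expected_words th q n * ((q + 1) + (th^-1 - 1) * n%:R).
Proof.
move=> h q1; have q0 : 0 < q + 1 by lra.
have /andP[th0 th1] := h.
have b0 : 0 < th^-1 - 1 by rewrite subr_gt0 invf_gt1.
have D0 : 0 < q + 1 + (th^-1 - 1) * n%:R.
  by apply: ltr_wpDr => //; apply: mulr_ge0 => //; exact: ltW.
rewrite -ler_pdivrMr//; apply: le_trans (expected_words_ge n h q1).
have p0 := @zipf_ge0 _ _ _ 0%N h q1; have := zipf_first_le h q1.
set p := zipf_mandelbrot _ _ _ in p0 *; set b := _ - 1 in b0 D0 *.
rewrite ler_pdivlMr// => pb.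
have P0 : 0 < 1 + n%:R * p by apply: ltr_wpDr => //; apply: mulr_ge0.
rewrite -mulrA ler_wpM2l// ler_pdivrMr// mulrC ler_pdivlMr// mulrDr mulr1.
rewrite lerD2l mulrCA mulrC ler_wpM2r//.
by rewrite mulrC.
Qed.

(** The words i with n p_i >= 1 are those with i+q <= y, where y is the number
    on the left; there are about y-q of them, and each one is seen with
    probability at least 1 - 1/e >= 1/2. *)
Lemma expected_words_ge_pow (R : realType) (th q : R) (n : nat) :
  0 < th < 1 -> -1 < q ->
  (n%:R / hurwitz_zeta th^-1 (q + 1)) `^ th <=
  2 * expected_words th q n + (q + 1).
Proof.
move=> h q1; have q0 : 0 < q + 1 by lra.
have /andP[th0 th1] := h.
have al1 : 1 < th^-1 by rewrite invf_gt1.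
have al0 : 0 < th^-1 by lra.
have p01 i : 0 <= zipf_mandelbrot th q i.+1 <= 1 by rewrite zipf_ge0 ?zipf_le1.
have c1 := @is_cvg_expected_words _ _ _ n h q1.
have u0 i : 0 <= 1 - (1 - zipf_mandelbrot th q i.+1) ^+ n.
  by case/andP: (onem_expr_le n (p01 i)).
have z0 := hurwitz_gt0 al1 q0.
set y := _ `^ th.
have r0 : 0 <= expected_words th q n by exact: lim_series_ge0.
have [yq|yq] := leP y q; first lra.
set m := Num.truncn (y - q).
have my : m%:R <= y - q by rewrite truncn_le; lra.
have ym : y - q < m%:R + 1 by rewrite natr1; exact: truncnS_gt.
suff : m%:R * 2^-1 <= expected_words th q n by lra.
apply: le_trans (series_le_lim m u0 c1).
apply: (@sum_nat_ge_const _ _ 0%N) => i /andP[_ im].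
have iy : i%:R + (q + 1) <= y.
  have : i.+1%:R <= m%:R :> R by rewrite ler_nat.
  by rewrite -natr1; lra.
have iq0 : 0 < i%:R + (q + 1) by apply: ltr_wpDl.
have np1 : 1 <= n%:R * zipf_mandelbrot th q i.+1.
  rewrite zipfE mulrA powRN ler_pdivlMr ?powR_gt0// mul1r.
  have -> : n%:R / hurwitz_zeta th^-1 (q + 1) = y `^ th^-1.
    by rewrite /y -powRrM mulfV ?gt_eqF// powRr1// divr_ge0// ltW.
  apply: ge0_ler_powR => //; [exact: ltW|exact: ltW|].
  by rewrite nnegrE; exact: powR_ge0.
have /andP[+ _] := exprN_sub_onem n (p01 i).
suff : expR (- (n%:R * zipf_mandelbrot th q i.+1)) <= 2^-1 by lra.
apply: (@le_trans _ _ (expR (- 1))); first by rewrite ler_expR lerN2.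
rewrite expRN lef_pV2 ?posrE ?expR_gt0//.
by have := expR_ge1Dx (1 : R); lra.
Qed.

(** Word 1 contributes at most 1, the others at most n p_i each. *)
Lemma expected_words_le_first (R : realType) (th q : R) (n : nat) :
  0 < th < 1 -> -1 < q ->
  expected_words th q n <= 1 + n%:R * (1 - zipf_mandelbrot th q 1).
Proof.
move=> h q1.
have p01 i : 0 <= zipf_mandelbrot th q i.+1 <= 1 by rewrite zipf_ge0 ?zipf_le1.
have c1 := @is_cvg_expected_words _ _ _ n h q1.
have c3 := is_cvg_zipf h q1.
rewrite /expected_words lim_series_recl//; apply: lerD.
  by rewrite gerBl exprn_ge0//; case/andP: (p01 0%N); lra.
have -> : 1 - zipf_mandelbrot th q 1 =
    limn (series (fun i => zipf_mandelbrot th q i.+2)).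
  by apply/eqP; rewrite subr_eq addrC -(lim_zipf h q1) lim_series_recl.
rewrite -lim_seriesMl; last exact: is_cvg_series_shift c3.
apply: lim_series_le.
- exact: is_cvg_series_shift c1.
- exact: is_cvg_seriesMl (is_cvg_series_shift c3).
- by move=> i; case/andP: (onem_expr_le n (p01 i.+1)).
Qed.

(** As q tends to -1 the first probability tends to 1:
    1 - p_1 = zeta(1/th,Q+1) / zeta(1/th,Q), and the denominator is at least
    its first term Q^(-1/th). *)
Lemma expected_words_le_q (R : realType) (th q : R) (n : nat) :
  0 < th < 1 -> -1 < q ->
  expected_words th q n <=
  1 + n%:R * (hurwitz_zeta th^-1 1 * (q + 1) `^ th^-1).
Proof.
move=> h q1; apply: le_trans (expected_words_le_first n h q1) _.
have q0 : 0 < q + 1 by lra.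
have /andP[th0 th1] := h.
have al1 : 1 < th^-1 by rewrite invf_gt1.
have z0 := hurwitz_gt0 al1 q0.
rewrite lerD2l ler_wpM2l// zipfE add0r.
set z := hurwitz_zeta _ (q + 1) in z0 *.
have zE : z = (q + 1) `^ (- th^-1) + hurwitz_zeta th^-1 (q + 1 + 1).
  rewrite /z /hurwitz_zeta lim_series_recl ?add0r; last exact: is_cvg_hurwitz.
  congr (_ + limn (series _)); apply/funext => i.
  by congr (_ `^ _); rewrite -[i.+1%:R]natr1; ring.
have h1 : hurwitz_zeta th^-1 (q + 1 + 1) <= hurwitz_zeta th^-1 1.
  by apply: hurwitz_nonincr; lra.
have h0 : 0 <= hurwitz_zeta th^-1 (q + 1 + 1).
  by apply/ltW/hurwitz_gt0 => //; lra.
move: (hurwitz_zeta _ (q + 1 + 1)) (hurwitz_zeta _ 1) zE h1 h0.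
clearbody z => z2 z1 zE h1 h0.
have w0 := powR_gt0 (- th^-1) q0.
have -> : (q + 1) `^ th^-1 = ((q + 1) `^ (- th^-1))^-1 by rewrite powRN invrK.
set w := _ `^ _ in zE w0 *.
have -> : 1 - z^-1 * w = z2 / z.
  have -> : z2 = z - w.
    by rewrite zE [w + _]addrC addrK.
  by field; rewrite gt_eqF.
apply: ler_pM => //; first by rewrite invr_ge0 ltW.
by rewrite lef_pV2 ?posrE// zE lerDl.
Qed.

(** * Continuity in q and the equation r(n) = m *)

Lemma expr_lipschitz (R : realType) (a b : R) (k : nat) :
  0 <= a <= 1 -> 0 <= b <= 1 -> `|a ^+ k - b ^+ k| <= k%:R * `|a - b|.
Proof.
move=> /andP[a0 a1] /andP[b0 b1]; rewrite subrXX normrM mulrC.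
rewrite ler_wpM2r// (le_trans (ler_norm_sum _ _ _))//.
rewrite -[X in _ <= X%:R]card_ord -sum1_card natr_sum; apply: ler_sum => i _.
by rewrite normrM !normrX !ger0_norm// mulr_ile1 ?exprn_ge0 ?exprn_ile1.
Qed.

(** Both (i+q)^(-1/th) and the normalizing constant are monotone in q and change
    by a factor at most rho, in opposite directions. *)
Lemma zipf_ratio (R : realType) (th q q' : R) (i : nat) :
  0 < th < 1 -> -1 < q -> q <= q' ->
  let rho := ((q' + 1) / (q + 1)) `^ th^-1 in
  zipf_mandelbrot th q i.+1 <= rho * zipf_mandelbrot th q' i.+1 /\
  zipf_mandelbrot th q' i.+1 <= rho * zipf_mandelbrot th q i.+1.
Proof.
move=> /andP[th0 th1] q1 qq' rho.
have al1 : 1 < th^-1 by rewrite invf_gt1.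
have al0 : 0 < th^-1 by lra.
have q0 : 0 < q + 1 by lra.
have q'0 : 0 < q' + 1 by lra.
have p0 (j : nat) (x : R) : 0 < x -> 0 < j%:R + x by move=> ?; apply: ltr_wpDl.
have rho0 : 0 <= rho by exact: powR_ge0.
have w1 j : (j%:R + (q + 1)) `^ (- th^-1) <= rho * (j%:R + (q' + 1)) `^ (- th^-1).
  rewrite !powRN ler_pdivlMr ?powR_gt0 ?p0// mulrC ler_pdivrMr ?powR_gt0 ?p0//.
  rewrite -powRM ?divr_ge0 ?(ltW (p0 _ _ _)) ?(ltW q0) ?(ltW q'0)//.
  apply: ge0_ler_powR; rewrite ?nnegrE ?(ltW al0) ?(ltW (p0 _ _ _))//.
    by rewrite mulr_ge0 ?divr_ge0 ?(ltW (p0 _ _ _)) ?(ltW q0) ?(ltW q'0).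
  rewrite mulrAC ler_pdivlMr// !mulrDr !mulrDl.
  have : 0 <= j%:R * (q' - q) by rewrite mulr_ge0//; lra.
  lra.
have w2 j : (j%:R + (q' + 1)) `^ (- th^-1) <= (j%:R + (q + 1)) `^ (- th^-1).
  by apply: powR_nonincr; rewrite ?(ltW al0) ?p0//; lra.
have z0 := hurwitz_gt0 al1 q0.
have z'0 := hurwitz_gt0 al1 q'0.
have z1 : hurwitz_zeta th^-1 (q' + 1) <= hurwitz_zeta th^-1 (q + 1).
  by apply: hurwitz_nonincr => //; lra.
have z2 : hurwitz_zeta th^-1 (q + 1) <= rho * hurwitz_zeta th^-1 (q' + 1).
  rewrite -lim_seriesMl; last exact: is_cvg_hurwitz.
  apply: lim_series_le => //; first exact: is_cvg_hurwitz.
  exact/is_cvg_seriesMl/is_cvg_hurwitz.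
rewrite !zipfE; split.
  rewrite mulrCA; apply: ler_pM; rewrite ?invr_ge0 ?(ltW z0) ?powR_ge0//.
  by rewrite lef_pV2.
rewrite mulrA; apply: ler_pM; rewrite ?invr_ge0 ?(ltW z'0) ?powR_ge0//.
by rewrite ler_pdivlMr// mulrC ler_pdivrMr.
Qed.

(** p^n is n-Lipschitz on [0,1], and |p_i - p'_i| <= (rho-1) (p_i + p'_i), whose
    sum is 2 (rho-1). *)
Lemma lim_onem_expr_ratio (R : realType) (p p' : R^nat) (rho : R) (n : nat) :
  (forall i, 0 <= p i <= 1) -> (forall i, 0 <= p' i <= 1) ->
  cvgn (series p) -> cvgn (series p') ->
  limn (series p) = 1 -> limn (series p') = 1 ->
  cvgn (series (fun i => 1 - (1 - p i) ^+ n)) ->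
  cvgn (series (fun i => 1 - (1 - p' i) ^+ n)) ->
  (forall i, p i <= rho * p' i /\ p' i <= rho * p i) ->
  `|limn (series (fun i => 1 - (1 - p i) ^+ n)) -
    limn (series (fun i => 1 - (1 - p' i) ^+ n))| <= 2 * n%:R * (rho - 1).
Proof.
move=> p01 p'01 cp cp' lp lp' c1 c2 ratio.
pose s := (fun i => n%:R * (rho - 1) * (p i + p' i)).
have cpp : cvgn (series (fun i => p i + p' i)) by exact: is_cvg_seriesD.
have cs : cvgn (series s) by exact: is_cvg_seriesMl.
have ls : limn (series s) = 2 * n%:R * (rho - 1).
  rewrite lim_seriesMl// (lim_seriesD cp cp') lp lp'; ring.
have bnd i : `|(1 - (1 - p i) ^+ n) - (1 - (1 - p' i) ^+ n)| <= s i.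
  have := p01 i; have := p'01 i; have := ratio i; rewrite /s.
  move: (p i) (p' i) => a b [r1 r2] b01 a01.
  have -> : 1 - (1 - a) ^+ n - (1 - (1 - b) ^+ n) = (1 - b) ^+ n - (1 - a) ^+ n.
    by ring.
  apply: le_trans (expr_lipschitz _ _ _) _; [lra|lra|].
  rewrite -mulrA ler_wpM2l//.
  have -> : 1 - b - (1 - a) = a - b by ring.
  rewrite ler_norml; apply/andP; split; nra.
rewrite -(lim_seriesB c1 c2); have cd := is_cvg_seriesB c1 c2.
rewrite -ls ler_norml; apply/andP; split.
  rewrite -mulN1r -lim_seriesMl//; apply: lim_series_le => //.
    exact: is_cvg_seriesMl.
  by move=> i; have := bnd i; rewrite ler_norml mulN1r => /andP[].
apply: lim_series_le => // i.
by have := bnd i; rewrite ler_norml => /andP[].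
Qed.

Lemma expected_words_ratio (R : realType) (th q q' : R) (n : nat) :
  0 < th < 1 -> -1 < q -> q <= q' ->
  `|expected_words th q n - expected_words th q' n| <=
  2 * n%:R * (((q' + 1) / (q + 1)) `^ th^-1 - 1).
Proof.
move=> h q1 qq'; have q'1 : -1 < q' by lra.
apply: lim_onem_expr_ratio.
- by move=> i; rewrite zipf_ge0 ?zipf_le1.
- by move=> i; rewrite zipf_ge0 ?zipf_le1.
- exact: is_cvg_zipf.
- exact: is_cvg_zipf.
- exact: lim_zipf.
- exact: lim_zipf.
- exact: is_cvg_expected_words.
- exact: is_cvg_expected_words.
- by move=> i; exact: zipf_ratio.
Qed.

(** With q = exp s - 1 the factor of [zipf_ratio] is exp ((t-s)/th), so this is
    the modulus of continuity that arises. *)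
Lemma continuous_expR_modulus (R : realType) (f : R -> R) (C a : R) :
  0 <= C -> 0 < a ->
  (forall s t, s <= t -> `|f s - f t| <= C * (expR (a * (t - s)) - 1)) ->
  continuous f.
Proof.
move=> C0 a0 fC x.
have key s t : `|f s - f t| <= C * (expR (a * `|s - t|) - 1).
  have [st|/ltW ts] := leP s t.
    by rewrite (distrC s) (ger0_norm (x := t - s)) ?subr_ge0//; exact: fC.
  by rewrite distrC (ger0_norm (x := s - t)) ?subr_ge0//; exact: fC.
have D0 : 0 < C + 1 by rewrite ltr_wpDl.
apply/cvgrPdist_le => e e0; near=> t.
apply: le_trans (key _ _) _.
have : a * `|x - t| <= ln (1 + e / (C + 1)).
  rewrite mulrC -ler_pdivlMr//.
  near: t; apply: cvgr_dist_le => //.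
  by rewrite divr_gt0// ln_gt0// ltrDl divr_gt0.
rewrite -ler_expR lnK ?posrE ?addr_gt0 ?divr_gt0// => H.
apply: (@le_trans _ _ (C * (e / (C + 1)))).
  by rewrite ler_wpM2l// lerBlDl.
by rewrite mulrCA ger_pMr// ler_pdivrMr// mul1r lerDl.
Unshelve. all: by end_near. Qed.

Lemma expected_words_continuous (R : realType) (th : R) (n : nat) :
  0 < th < 1 -> continuous (fun s => expected_words th (expR s - 1) n).
Proof.
move=> h; have /andP[th0 th1] := h.
apply: (@continuous_expR_modulus _ _ (2 * n%:R) th^-1).
- by rewrite mulr_ge0.
- by rewrite invr_gt0.
- move=> s t st.
  have -> : expR (th^-1 * (t - s)) = ((expR t - 1 + 1) / (expR s - 1 + 1)) `^ th^-1.
    by rewrite !subrK -expRB -expRM [_ * th^-1]mulrC.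
  apply: expected_words_ratio => //.
  + by rewrite ltrBrDr addrC subrr expR_gt0.
  + by rewrite lerD2r ler_expR.
Qed.

(** The intermediate value theorem in the variable s = ln (q+1), which ranges
    over the whole line. *)
Lemma expected_words_onto (R : realType) (th : R) (n m : nat) :
  0 < th < 1 -> (1 < m)%N -> (m < n)%N ->
  exists2 q, -1 < q & expected_words th q n = m%:R.
Proof.
move=> h m1 mn; have /andP[th0 th1] := h.
have al1 : 1 < th^-1 by rewrite invf_gt1.
have z0 := hurwitz_gt0 al1 (@ltr01 R).
have n0 : 0 < n%:R :> R by rewrite ltr0n; lia.
have m2 : 2 <= m%:R :> R by rewrite ler_nat.
have mn1 : m%:R <= n%:R - 1 :> R by rewrite lerBrDr natr1 ler_nat.
have n1 : 1 <= n%:R - 1 :> R by lra.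
have N1 s : -1 < expR s - 1 :> R by rewrite ltrBrDr addrC subrr expR_gt0.
pose f s := expected_words th (expR s - 1) n.
(* The choice of a makes the upper bound of [expected_words_le_q] equal to 2,
   the choice of b the lower bound of [expected_words_ge_q] at least n-1. *)
pose a := - (th * ln (n%:R * hurwitz_zeta th^-1 1)).
have fa : f a <= m%:R.
  apply: le_trans (expected_words_le_q n h (N1 a)) _; rewrite subrK.
  have -> : expR a `^ th^-1 = (n%:R * hurwitz_zeta th^-1 1)^-1.
    rewrite -expRM /a mulNr mulrAC mulfV ?gt_eqF// mul1r expRN lnK//.
    by rewrite posrE mulr_gt0.
  by rewrite mulrA mulfV ?gt_eqF ?mulr_gt0//; lra.
pose b := n%:R ^+ 2 * th^-1.
have fb : m%:R <= f b.
  have := expected_words_ge_q n h (N1 b); rewrite subrK -/(f b).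
  have := expR_ge1Dx b; set Q := expR b => Qb.
  have b0 : 0 < b by rewrite mulr_gt0 ?exprn_gt0//; lra.
  have D0 : 0 < Q + (th^-1 - 1) * n%:R.
    by apply: addr_gt0; [lra|apply: mulr_gt0 => //; lra].
  rewrite -ler_pdivrMr//; apply: le_trans.
  apply: le_trans mn1 _; rewrite ler_pdivlMr//.
  have : (n%:R - 1) * ((th^-1 - 1) * n%:R) <= b.
    have -> : b = n%:R * (th^-1 * n%:R) by rewrite /b; ring.
    apply: ler_pM; rewrite ?ler_wpM2r//; [lra| |lra|lra].
    by apply: mulr_ge0 => //; lra.
  lra.
have fE s : f s = expected_words th (expR s - 1) n by [].
have fcont : continuous f by exact: expected_words_continuous.
clearbody f a b.
have [c _ fc] : exists2 c, c \in `[Num.min a b, Num.max a b] & f c = m%:R.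
  apply: IVT; first by rewrite le_max ge_min lexx.
    exact: continuous_subspaceT.
  by rewrite ge_min le_max; case: (leP a b) => _; rewrite fa fb ?orbT.
by exists (expR c - 1); rewrite -?fE.
Qed.

(** * The Stieltjes integral against a piecewise C^1 function with jumps *)

(** Partitions are encoded as iterated concatenations of intervals: two of them
    are merged by induction, without building a common refinement as a sorted
    list. *)
Inductive piecewise (R : realType) (Q : R -> R -> Prop) : R -> R -> Prop :=
| piecewise_one a b : a < b -> Q a b -> piecewise Q a b
| piecewise_cat a b c : piecewise Q a b -> piecewise Q b c -> piecewise Q a c.

Lemma piecewise_lt (R : realType) (Q : R -> R -> Prop) (a b : R) :
  piecewise Q a b -> a < b.
Proof. by elim=> // {}a {}b c _ ab _ bc; exact: lt_trans bc. Qed.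

Lemma piecewise_itv_partition (R : realType) (Q : R -> R -> Prop) (a b : R)
  (s : seq R) : itv_partition a b s -> a < b ->
  (forall i, (i < size s)%N -> Q (a :: s)`_i s`_i) -> piecewise Q a b.
Proof.
elim: s a => [a /itv_partition_nil ->|x s ih a sP ab Qs]; first by rewrite ltxx.
have /andP[ax _] := sP.1.
have Qax : Q a x := Qs 0%N isT.
have xb := itv_partition_cons sP.
have [xb_eq|nxb] := eqVneq x b; first by rewrite -xb_eq; exact: piecewise_one.
apply: (@piecewise_cat _ _ _ x); first exact: piecewise_one.
apply: ih => //; first by rewrite lt_neqAle nxb (itv_partition_le xb).
by move=> i si; exact: (Qs i.+1 si).
Qed.

Definition itv_hereditary (R : realType) (Q : R -> R -> Prop) :=
  forall a b u v, a <= u -> v <= b -> Q a b -> Q u v.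

Lemma piecewise_sub (R : realType) (Q : R -> R -> Prop) (a b u v : R) :
  itv_hereditary Q -> piecewise Q a b -> a <= u -> u < v -> v <= b ->
  piecewise Q u v.
Proof.
move=> hQ pQ; elim: pQ u v => {a b}
  [a b ab Qab u v au uv vb|a b c _ ih1 _ ih2 u v au uv vc].
  by apply: piecewise_one => //; exact: hQ Qab.
have [vb|bv] := leP v b; first exact: ih1.
have [bu|ub] := leP b u; first exact: ih2.
by apply: (@piecewise_cat _ _ _ b); [exact: ih1|exact: ih2].
Qed.

Lemma piecewise_and (R : realType) (Q1 Q2 : R -> R -> Prop) (a b : R) :
  itv_hereditary Q1 -> itv_hereditary Q2 ->
  piecewise Q1 a b -> piecewise Q2 a b ->
  piecewise (fun x y => Q1 x y /\ Q2 x y) a b.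
Proof.
move=> h1 h2; elim=> {a b} [a b ab Q1ab|a b c p1 ih1 p2 ih2] pQ2.
  have : forall x y, piecewise Q2 x y -> Q1 x y ->
      piecewise (fun x y => Q1 x y /\ Q2 x y) x y; last by apply.
  move=> {a b ab Q1ab pQ2} x y; elim=> {x y} [x y xy Q2xy Q1xy|x y z xy ih1 yz ih2 Q1xz].
    exact: piecewise_one.
  have lxy := ltW (piecewise_lt xy); have lyz := ltW (piecewise_lt yz).
  by apply: (@piecewise_cat _ _ _ y); [apply: ih1; apply: h1 Q1xz|
    apply: ih2; apply: h1 Q1xz].
have ab := piecewise_lt p1; have bc := piecewise_lt p2.
apply: (@piecewise_cat _ _ _ b); [apply: ih1|apply: ih2].
  by apply: piecewise_sub pQ2 _ _ _ => //; exact: ltW.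
by apply: piecewise_sub pQ2 _ _ _ => //; exact: ltW.
Qed.

Lemma piecewise_imp (R : realType) (Q1 Q2 : R -> R -> Prop) (a b : R) :
  (forall x y, a <= x -> y <= b -> Q1 x y -> Q2 x y) ->
  piecewise Q1 a b -> piecewise Q2 a b.
Proof.
move=> h p; elim: p h => {a b} [a b ab Q1ab h|a b c p1 ih1 p2 ih2 h].
  by apply: piecewise_one => //; exact: h.
apply: (@piecewise_cat _ _ _ b); [apply: ih1|apply: ih2] => x y ? ?; apply: h => //.
  by apply: le_trans (ltW (piecewise_lt p2)).
by apply: le_trans (ltW (piecewise_lt p1)) _.
Qed.

Definition C1_piece (R : realType) (f : R -> R) (a b : R) : Prop :=
  exists g : R -> R, [/\ forall t, derivable g t 1, continuous (derive1 g)
    & {in `]a, b[, f =1 g}].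

Definition cst_piece (R : realType) (f : R -> R) (a b : R) : Prop :=
  exists c, {in `]a, b[, forall t, f t = c}.

Lemma C1_piece_hereditary (R : realType) (f : R -> R) :
  itv_hereditary (C1_piece f).
Proof.
move=> a b u v au vb [g [g1 g2 g3]]; exists g; split => // t.
by rewrite in_itv/= => /andP[ut tv]; apply: g3;
  rewrite in_itv/= (le_lt_trans au) ?(lt_le_trans tv).
Qed.

Lemma cst_piece_hereditary (R : realType) (f : R -> R) :
  itv_hereditary (cst_piece f).
Proof.
move=> a b u v au vb [c h]; exists c => t.
by rewrite in_itv/= => /andP[ut tv]; apply: h;
  rewrite in_itv/= (le_lt_trans au) ?(lt_le_trans tv).
Qed.

(** Unlike [jump01] it makes no exception for the ends of an interval, so it is
    not affected by the concatenation of intervals. *)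
Definition jump (R : realType) (f : R -> R) (t : R) : R :=
  lim (f x @[x --> t^'+]) - lim (f x @[x --> t^'-]).

Lemma near_itvoo (R : realType) (a b t : R) : a < t < b ->
  \forall x \near t, x \in `]a, b[.
Proof.
by move=> tab; apply: near_in_itvoo; rewrite in_itv.
Qed.

(** On the open interval f may be replaced by the C^1 function g it agrees with,
    whose one-sided limits at the end points are its values. *)
Lemma C1_piece_FTC (R : realType) (f : R -> R) (a b : R) : a < b ->
  C1_piece f a b ->
  exists la lb : R, [/\ f x @[x --> a^'+] --> la, f x @[x --> b^'-] --> lb,
    {in `]a, b[, forall t, jump f t = 0},
    (@lebesgue_measure R).-integrable `]a, b[ (EFin \o derive1 f) &
    Rintegral (@lebesgue_measure R) `]a, b[ (derive1 f) = lb - la].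
Proof.
move=> ab [g [dg cg fg]].
have cont : continuous g.
  by move=> t; apply: differentiable_continuous; apply/derivable1_diffP.
have near_fg t : t \in `]a, b[ -> \forall x \near t, f x = g x.
  move=> tab; near=> x; apply: fg.
  by near: x; apply: near_itvoo; move: tab; rewrite in_itv.
have f'g : {in `]a, b[, derive1 g =1 derive1 f}.
  move=> t tab; rewrite !derive1E; apply: near_eq_derive.
  by near do apply/esym; exact: near_fg.
have int : (@lebesgue_measure R).-integrable `[a, b] (EFin \o derive1 g).
  apply: continuous_compact_integrable; first exact: segment_compact.
  exact: continuous_subspaceT.
have int2 : (@lebesgue_measure R).-integrable `]a, b[ (EFin \o derive1 g).
  by apply: integrableS int => //; exact: subset_itv_oo_cc.
have cw : {within `[a, b], continuous (derive1 g)} by exact: continuous_subspaceT.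
have dLR : derivable_oo_LRcontinuous g a b.
  split; [by move=> t _; exact: dg|apply: cvg_at_right_filter; exact: cont|
    apply: cvg_at_left_filter; exact: cont].
have FTC : Rintegral (@lebesgue_measure R) `[a, b] (derive1 g) = g b - g a.
  rewrite /Rintegral (_ : (\int[_]_(x in _) _)%E = (g b)%:E - (g a)%:E)%E//.
  exact: (continuous_FTC2 ab cw dLR (fun t _ => erefl)).
exists (g a), (g b); split.
- have : g x @[x --> a^'+] --> g a by apply: cvg_at_right_filter; exact: cont.
  apply: cvg_trans; apply: near_eq_cvg; near=> x; apply/esym/fg.
  rewrite in_itv/=; apply/andP; split; near: x; first exact: nbhs_right_gt.
  exact: nbhs_right_lt.
- have : g x @[x --> b^'-] --> g b by apply: cvg_at_left_filter; exact: cont.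
  apply: cvg_trans; apply: near_eq_cvg; near=> x; apply/esym/fg.
  rewrite in_itv/=; apply/andP; split; near: x; last exact: nbhs_left_lt.
  exact: nbhs_left_gt.
- move=> t tab.
  have : f x @[x --> t] --> g t.
    have : g x @[x --> t] --> g t by exact: cont.
    apply: cvg_trans; apply: near_eq_cvg; near do apply/esym; exact: near_fg.
  move=> h; rewrite /jump (cvg_lim _ (cvg_at_right_filter h))//.
  by rewrite (cvg_lim _ (cvg_at_left_filter h))// subrr.
- apply: eq_integrable int2 => // t; rewrite inE/= => tab.
  by rewrite f'g.
- transitivity (Rintegral (@lebesgue_measure R) `]a, b[ (derive1 g)).
    by apply: eq_Rintegral => t; rewrite inE/= => tab; exact/esym/f'g.
  rewrite Rintegral_itv_obnd_cbnd// Rintegral_itv_bndo_bndc; last first.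
    by apply: integrableS int => //; exact: subset_itv_co_cc.
  exact: FTC.
Unshelve. all: by end_near. Qed.

Lemma integrable_setU_disj (d : measure_display) (T : measurableType d)
  (R : realType) (mu : {measure set T -> \bar R}) (A B : set T) (f : T -> \bar R) :
  measurable A -> measurable B -> [disjoint A & B] ->
  mu.-integrable A f -> mu.-integrable B f -> mu.-integrable (A `|` B) f.
Proof.
move=> mA mB AB /integrableP[mfA iA] /integrableP[mfB iB].
have mf : measurable_fun (A `|` B) f by apply/measurable_funU.
apply/integrableP; split => //.
rewrite ge0_integral_setU//; last exact: measurableT_comp.
exact: lte_add_pinfty.
Qed.

(** Concatenating two pieces at b adds the jump at b, which is exactly the
    difference between the right limit at b of the second piece and the left
    limit at b of the first one. *)
Lemma piecewise_C1_FTC (R : realType) (f : R -> R) (a b : R) :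
  piecewise (C1_piece f) a b ->
  exists (la lb : R) (s : seq R), [/\ f x @[x --> a^'+] --> la,
    f x @[x --> b^'-] --> lb,
    [/\ uniq s, {in s, forall t, a < t < b} &
      {in `]a, b[, forall t, t \notin s -> jump f t = 0}],
    (@lebesgue_measure R).-integrable `]a, b[ (EFin \o derive1 f) &
    \sum_(t <- s) jump f t +
      Rintegral (@lebesgue_measure R) `]a, b[ (derive1 f) = lb - la].
Proof.
elim=> {a b} [a b ab|a b c pab [la [lb [s1 [fa fb [us1 s1ab s10] int1 S1]]]]
    pbc [lb' [lc [s2 [fb' fc [us2 s2bc s20] int2 S2]]]]].
  move=> /(C1_piece_FTC ab)[la [lb [fa fb j0 int S]]].
  exists la, lb, [::]; split => //; last by rewrite big_nil add0r.
  by split => // t tab _; exact: j0.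
have ab := piecewise_lt pab; have bc := piecewise_lt pbc.
have jb : jump f b = lb' - lb.
  by rewrite /jump (cvg_lim _ fb')// (cvg_lim _ fb).
have bs1 : b \notin s1 by apply/negP => /s1ab; rewrite ltxx andbF.
have bs2 : b \notin s2 by apply/negP => /s2bc; rewrite ltxx.
have dec : `]a, c[%classic = `]a, b[ `|` (b |` `]b, c[) :> set R.
  rewrite setUA; apply/seteqP; split => t /=; rewrite !in_itv/=.
    by move=> /andP[at0 tc]; case: (ltgtP t b) => tb; rewrite ?at0 ?tc; auto.
  move=> [[/andP[at0 tb]|->]|/andP[bt tc]].
  - by rewrite at0 (lt_trans tb).
  - by rewrite ab.
  - by rewrite (lt_trans ab).
have disj1 : [disjoint [set b] & `]b, c[%classic].
  by apply/disj_setPS => t [/= ->]; rewrite in_itv/= ltxx.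
have disj2 : [disjoint `]a, b[%classic & b |` `]b, c[%classic].
  apply/disj_setPS => t [/=]; rewrite in_itv/= => /andP[_ tb] [/= te|].
    by rewrite te ltxx in tb.
  by rewrite in_itv/= => /andP[bt _]; rewrite ltNge (ltW bt) in tb.
have int2' : (@lebesgue_measure R).-integrable (b |` `]b, c[) (EFin \o derive1 f).
  apply: integrable_setU_disj => //; apply/integrableP; split.
    exact: measurable_fun_set1.
  by rewrite integral_set1.
have mbc : measurable (b |` `]b, c[%classic) by apply: measurableU.
have int : (@lebesgue_measure R).-integrable `]a, c[ (EFin \o derive1 f).
  by rewrite dec; apply: integrable_setU_disj.
exists la, lc, (s1 ++ b :: s2); split => //.
- split.
  + rewrite cat_uniq us1/= us2 bs2/= negb_or bs1/= andbT.
    apply/hasPn => t /s2bc/andP[bt _]; apply/negP => /s1ab/andP[_].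
    by rewrite ltNge ltW.
  + move=> t; rewrite mem_cat inE => /or3P[/s1ab/andP[at0 tb]|/eqP->|/s2bc/andP[bt tc]].
    * by rewrite at0 (lt_trans tb).
    * by rewrite ab.
    * by rewrite (lt_trans ab).
  + move=> t; rewrite in_itv/= => /andP[at0 tc].
    rewrite mem_cat inE !negb_or => /and3P[ts1 tb ts2].
    move: tb; rewrite neq_lt => /orP[tb|tb].
      by apply: s10; rewrite ?in_itv/= ?at0.
    by apply: s20; rewrite ?in_itv/= ?tb.
- rewrite big_cat big_cons/= jb dec.
  rewrite Rintegral_setU//; last by rewrite -dec.
  rewrite Rintegral_setU// Rintegral_set1 add0r.
  by move: S1 S2; lra.
Qed.

Lemma admissible_pieces (R : realType) (A : R -> R) :
  admissible A -> piecewise (C1_piece A) 0 1.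
Proof.
move=> [[S [B [[s1 s1P Sc] [s2 s2P Bg] ASB]]] _ _ _].
have pS : piecewise (cst_piece S) 0 1 by exact: piecewise_itv_partition s1P _ Sc.
have pB : piecewise (C1_piece B) 0 1 by exact: piecewise_itv_partition s2P _ Bg.
have := piecewise_and (@cst_piece_hereditary _ S) (@C1_piece_hereditary _ B) pS pB.
apply: piecewise_imp => x y x0 y1 [[c Sxy] [g [dg cg Bxy]]].
exists (fun t => c + g t); split.
- by move=> t; apply: derivableD.
- have -> : derive1 (fun t => c + g t) = derive1 g; last by [].
  apply/funext => t; rewrite !derive1E deriveD//.
  by rewrite derive_cst add0r.
- move=> t txy; rewrite ASB ?Sxy ?Bxy//.
  move: txy; rewrite !in_itv/= => /andP[xt ty].
  by rewrite (le_trans x0 (ltW xt)) (le_trans (ltW ty) y1).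
Qed.

Lemma near0_jump_derive1 (R : realType) (f : R -> R) (t : R) :
  (\forall x \near t, f x = 0) -> jump f t = 0 /\ derive1 f t = 0.
Proof.
move=> f0; split.
  have h : f x @[x --> t] --> (0 : R).
    have : (fun=> 0) x @[x --> t] --> (0 : R) by exact: cvg_cst.
    by apply: cvg_trans; apply: near_eq_cvg; near do apply/esym.
  by rewrite /jump (cvg_lim _ (cvg_at_right_filter h))//
    (cvg_lim _ (cvg_at_left_filter h))// subrr.
rewrite derive1E (@near_eq_derive _ _ _ f (cst 0))// derive_cst//.
Unshelve. all: by end_near. Qed.

(** The measure dA has total mass A(1) - A(0) = 0: there is no jump at 0, and
    the jump at 1 is minus the left limit of A there.  Its atoms and its density
    live on [delta,1], because A is 0 on [0,delta]. *)
Lemma admissible_FTC (R : realType) (A : R -> R) : admissible A ->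
  exists (delta : R) (s : seq R), [/\ 0 < delta < 1,
    [/\ uniq s, {in s, forall t, delta <= t <= 1} &
      {in `[0, 1], forall t, t \notin s -> jump01 A t = 0}],
    (@lebesgue_measure R).-integrable `]0, 1] (EFin \o derive1 A),
    {in `]0, delta[, forall t, derive1 A t = 0} &
    \sum_(t <- s) jump01 A t +
      Rintegral (@lebesgue_measure R) `]0, 1] (derive1 A) = 0].
Proof.
move=> hA; have pA := admissible_pieces hA.
case: hA => _ [delta /andP[d0 d1] A0] [A00 A0r A1] _.
have [la [lb [s [Ala Alb [us s01 sj] int FTC]]]] := piecewise_C1_FTC pA.
have la0 : la = 0.
  by rewrite -(cvg_lim _ Ala)// (cvg_lim _ A0r).
have small t : 0 < t < delta -> jump A t = 0 /\ derive1 A t = 0.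
  move=> td; apply: near0_jump_derive1; near=> x; apply: A0.
  apply: subset_itv_oo_cc; near: x; exact: near_itvoo.
have j01 t : 0 < t < 1 -> jump01 A t = jump A t.
  by move=> /andP[t0 t1]; rewrite /jump01 t0 t1.
have j1 : jump01 A 1 = - lb.
  by rewrite /jump01 ltxx ltr01 A1 (cvg_lim _ Alb)// add0r.
have j0 : jump01 A 0 = 0.
  by rewrite /jump01 ltxx ltr01 A00 (cvg_lim _ A0r)// subr0.
pose s' := 1 :: [seq t <- s | delta <= t].
have int' : (@lebesgue_measure R).-integrable `]0, 1] (EFin \o derive1 A).
  rewrite -(@setUitv1 _ _ _ _ true); last by rewrite bnd_simp.
  apply: integrable_setU_disj => //.
    by apply/disj_setPS => t [/= + t1]; rewrite t1 in_itv/= ltxx andbF.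
  apply/integrableP; split; first exact: measurable_fun_set1.
  by rewrite integral_set1.
exists delta, s'; split => //.
- by rewrite d0 d1.
- split.
  + rewrite /= filter_uniq// andbT mem_filter negb_and; apply/orP; right.
    by apply/negP => /s01; rewrite ltxx andbF.
  + move=> t; rewrite inE mem_filter => /orP[/eqP->|/andP[dt /s01/andP[_ t1]]].
      by rewrite lexx ltW.
    by rewrite dt ltW.
  + move=> t; rewrite in_itv/= => /andP[t0 t1].
    rewrite inE mem_filter negb_or => /andP[tn1].
    move: t0; rewrite le_eqVlt => /orP[/eqP<- //|t0].
    have {}t1 : t < 1 by rewrite lt_neqAle tn1.
    have [dt ts|td _] := leP delta t.
      by rewrite j01 ?t0// sj ?in_itv/= ?t0.
    by rewrite j01 ?t0//; have [] := small t; rewrite ?t0.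
- by move=> t; rewrite in_itv/= => td; have [] := small t td.
- rewrite big_cons j1 big_filter.
  rewrite -Rintegral_itv_bndo_bndc//.
  have -> : \sum_(t <- s | delta <= t) jump01 A t = \sum_(t <- s) jump A t.
    rewrite big_mkcond/= !big_seq; apply: eq_bigr => t /s01 t01.
    have /andP[t0 t1] := t01; have [dt|td] := leP delta t; first exact: j01.
    by apply/esym; have [] := small t; rewrite ?t0.
  by move: FTC; rewrite la0; lra.
Unshelve. all: by end_near. Qed.

Lemma stieltjes01E (R : realType) (A f : R -> R) (s : seq R) :
  uniq s -> {in s, forall t, 0 <= t <= 1} ->
  {in `[0, 1], forall t, t \notin s -> jump01 A t = 0} ->
  (@lebesgue_measure R).-integrable `]0, 1] (EFin \o (fun t => f t * derive1 A t)) ->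
  stieltjes01 A f = \sum_(t <- s) f t * jump01 A t +
    Rintegral (@lebesgue_measure R) `]0, 1] (fun t => f t * derive1 A t).
Proof.
move=> us s01 sj int; rewrite /stieltjes01; congr (_ + _); last first.
  by rewrite Rintegral_itv_obnd_cbnd.
apply/esym; rewrite (fsbig_seq _ _ us); apply: fsbig_widen.
  by move=> t /= /s01; rewrite in_itv.
move=> t [/= t01 /negP ts]; by rewrite /= sj ?mulr0.
Qed.

(** If h is uniformly e-close to th ln + C on the set [delta,1] carrying dA, its
    integral is within V e of th * 1 + C * 0, where V is the total variation of
    dA. *)
Lemma stieltjes01_near (R : realType) (A : R -> R) : admissible A ->
  exists delta V : R, [/\ 0 < delta < 1, 0 <= V &
    forall (h : R -> R) (th C e M : R),
      measurable_fun [set: R] h -> (forall t, 0 < t <= 1 -> `|h t| <= M) ->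
      0 <= e ->
      (forall t, delta <= t <= 1 -> `|h t - (th * ln t + C)| <= e) ->
      `|stieltjes01 A h - th| <= V * e].
Proof.
move=> hA; have [delta [s [d01 [us sd sj] int k0 FTC]]] := admissible_FTC hA.
have /andP[d0 d1] := d01.
have st1 : stieltjes01 A (@ln R) = 1 by case: hA.
set D := (`]0, 1]%classic : set (measurableTypeR R)) in int FTC *.
set mu := (@lebesgue_measure R : {measure set (measurableTypeR R) -> \bar R}) in int FTC *.
set k := derive1 A in int k0 FTC *; set j := jump01 A in sj FTC *.
have mD : measurable D by exact: measurable_itv.
have s01 : {in s, forall t, 0 <= t <= 1}.
  by move=> t /sd/andP[dt ->]; rewrite (le_trans (ltW d0)).
exists delta, (\sum_(t <- s) `|j t| + Rintegral mu D (fun t => `|k t|)).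
split => //.
  by rewrite addr_ge0 ?sumr_ge0//; apply: Rintegral_ge0.
move=> h th C e M mhT hM e0 he.
(* ln is unbounded near 0; ln' agrees with it where dA lives and is bounded, so
   the integrals can be split. *)
pose ln' t := ln (Num.max t delta) : R.
have intM (f : R -> R) (N : R) : measurable_fun D f ->
    (forall t, 0 < t <= 1 -> `|f t| <= N) ->
    mu.-integrable D (EFin \o (fun t => f t * k t)).
  move=> mf fN; have bf : [bounded f t | t in D].
    exists N; split; first exact: num_real.
    move=> x Nx t; rewrite /D/= in_itv/= => t01.
    by apply: le_trans (fN t t01) (ltW Nx).
  by have := integrableMr mD mf bf int; apply: eq_integrable.
have mln : measurable_fun D ln'.
  apply: nondecreasing_measurable => // x y xy.
  rewrite ler_ln ?posrE ?lt_max ?d0 ?orbT// ge_max !le_max xy lexx orbT//.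
have lnE : {in D, forall t, ln t * k t = ln' t * k t}.
  move=> t; rewrite inE/D/= in_itv/= => /andP[t0 t1].
  have [dt|td] := leP delta t; first by rewrite /ln' max_l.
  by rewrite k0 ?mulr0// in_itv/= t0.
have mh : measurable_fun D h by exact: measurable_funTS.
have lnM t : 0 < t <= 1 -> `|ln' t| <= - ln delta.
  move=> /andP[t0 t1].
  have : ln delta <= ln' t by rewrite ler_ln ?posrE ?lt_max ?d0 ?orbT// le_max lexx orbT.
  have l0 : ln' t <= 0 by apply: ln_le0; rewrite ge_max t1 ltW.
  by move=> ?; rewrite ler0_norm// lerN2.
have ih := intM _ _ mh hM; have iln := intM _ _ mln lnM.
have iln2 : mu.-integrable D (EFin \o (fun t => ln t * k t)).
  by apply: eq_integrable iln => // t tD; rewrite /= lnE.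
rewrite (stieltjes01E us s01 sj ih).
move: st1; rewrite (stieltjes01E us s01 sj iln2) -/mu -/D -/k -/j.
rewrite (eq_Rintegral _ lnE) => st1.
pose u t := h t - (th * ln' t + C).
have uE : \sum_(t <- s) h t * j t + Rintegral mu D (fun t => h t * k t) - th =
    \sum_(t <- s) u t * j t + Rintegral mu D (fun t => u t * k t).
  have -> : \sum_(t <- s) u t * j t = \sum_(t <- s) h t * j t -
      (th * (\sum_(t <- s) ln t * j t) + C * \sum_(t <- s) j t).
    rewrite !mulr_sumr -big_split/= -sumrB !big_seq; apply: eq_bigr => t /sd/andP[dt _].
    by rewrite /u /ln' max_l//; ring.
  have -> : Rintegral mu D (fun t => u t * k t) =
      Rintegral mu D (fun t => h t * k t) -
      (th * Rintegral mu D (fun t => ln' t * k t) + C * Rintegral mu D k).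
    have i1 : mu.-integrable D (EFin \o (fun t => th * (ln' t * k t))).
      by have := integrableZl mD th iln; apply: eq_integrable.
    have i2 : mu.-integrable D (EFin \o (fun t => C * k t)).
      by have := integrableZl mD C int; apply: eq_integrable.
    have i12 : mu.-integrable D (EFin \o (fun t => th * (ln' t * k t) + C * k t)).
      by have := integrableD mD i1 i2; apply: eq_integrable.
    rewrite -(RintegralZl th mD iln) -(RintegralZl C mD int).
    rewrite -(RintegralD mD i1 i2) -(RintegralB mD ih i12).
    by apply: eq_Rintegral => t _; rewrite /u; ring.
  have := congr1 ( *%R th) st1; have := congr1 ( *%R C) FTC.
  by rewrite !mulrDr mulr1 mulr0; lra.
rewrite uE mulrDl; apply: le_trans (ler_normD _ _) _; apply: lerD.
  apply: le_trans (ler_norm_sum _ _ _) _; rewrite mulr_suml !big_seq.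
  apply: ler_sum => t /sd td; have /andP[dt _] := td.
  by rewrite normrM mulrC ler_wpM2l// /u /ln' max_l// he.
have iu : mu.-integrable D (EFin \o (fun t => u t * k t)).
  apply: (intM _ (M + (`|th| * (- ln delta) + `|C|))).
    apply: measurable_funB => //; apply: measurable_funD => //.
    exact: measurable_funM.
  move=> t t01; rewrite /u (le_trans (ler_normB _ _))// lerD ?hM//.
  by rewrite (le_trans (ler_normD _ _))// lerD2r normrM ler_wpM2l ?lnM.
apply: le_trans (le_normr_Rintegral mD iu) _.
have iak : mu.-integrable D (EFin \o (fun t => `|k t|)) by exact: integrable_norm.
rewrite -RintegralZr//; apply: le_Rintegral => //.
- exact: integrable_norm.
- by have := integrableZr mD e iak; apply: eq_integrable.
- move=> t Dt; rewrite normrM mulrC.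
  move: Dt; rewrite /D/= in_itv/= => /andP[t0 t1].
  have [dt|td] := leP delta t.
    by rewrite ler_wpM2l// /u /ln' max_l// he// dt.
  by rewrite (k0 t) ?in_itv/= ?t0// normr0 !mul0r.
Qed.

(** * Counting by indicators: first two moments and Chebyshev's inequality *)

(** The number of different words is a sum of indicators over the dictionary. *)
Lemma eseries_mem_size (R : realType) (s : seq nat) :
  (\sum_(0 <= i <oo) ((i \in s)%:R : R)%:E = (size (undup s))%:R%:E)%E.
Proof.
pose N := (\max_(i <- s) i).+1.
have Ns i : i \in s -> (i < N)%N by move=> si; rewrite ltnS; exact: leq_bigmax_seq.
have h n : (\sum_(0 <= i < n + N) ((i \in s)%:R : R)%:E = (size (undup s))%:R%:E)%E.
  rewrite sumEFin; congr EFin.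
  rewrite -natr_sum; congr (_%:R).
  rewrite -sum1_size.
  transitivity (\sum_(i <- iota 0 (n + N) | i \in s) 1)%N.
    rewrite [RHS]big_mkcond/= /index_iota subn0; apply: eq_bigr => i _.
    by case: (i \in s).
  rewrite -big_filter; apply: perm_big; apply: uniq_perm.
  - by rewrite filter_uniq// iota_uniq.
  - exact: undup_uniq.
  - move=> i; rewrite mem_filter mem_undup mem_iota add0n.
    case si : (i \in s) => //=.
    by rewrite (leq_trans (Ns i si))// leq_addl.
have H : (fun n => \sum_(0 <= i < n) ((i \in s)%:R : R)%:E)%E @ \oo -->
    ((size (undup s))%:R%:E : \bar R).
  rewrite -(cvg_shiftn N).
  rewrite [X in X @ _ --> _](_ : _ = cst (size (undup s))%:R%:E); first exact: cvg_cst.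
  by apply/funext => n; exact: h.
exact: cvg_lim H.
Qed.

Lemma nneseries_EFin (R : realType) (f : R^nat) : cvgn (series f) ->
  (\sum_(0 <= i <oo) (f i)%:E = (limn (series f))%:E)%E.
Proof.
move=> cf; rewrite -EFin_lim//; congr (limn _).
by apply/funext => n; rewrite sumEFin.
Qed.

Section second_moment.
Local Open Scope ereal_scope.

(** E Y^2 is the sum over i and k of P (E_i and E_k); the off-diagonal terms are
    at most p_i p_k, which sum to at most m^2, and the diagonal adds m. *)
Lemma indicator_sum_moments (d : measure_display) (T : measurableType d)
  (R : realType) (P : probability T R) (E : nat -> set T) (p : R^nat) (Y : T -> R) :
  (forall i, measurable (E i)) -> (forall i, (0 <= p i)%R) ->
  cvgn (series p) ->
  (forall i, P (E i) = (p i)%:E) ->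
  (forall i k, i != k -> P (E i `&` E k) <= (p i * p k)%:E) ->
  measurable_fun [set: T] Y -> (forall w, (0 <= Y w)%R) ->
  (forall w, \sum_(0 <= i <oo) (\1_(E i) w : R)%:E = (Y w)%:E) ->
  let m := limn (series p) in
  \int[P]_w (Y w)%:E = m%:E /\ \int[P]_w (Y w ^+ 2)%:E <= (m + m ^+ 2)%:E.
Proof.
move=> mE p0 cp PE PEE mY Y0 YE m.
have mI i : measurable_fun [set: T] (fun w => (\1_(E i) w : R)%:E).
  exact/measurable_EFinP/measurable_indic.
have YI : \int[P]_w (Y w)%:E = m%:E.
  under eq_integral do rewrite -YE.
  rewrite integral_nneseries//.
  rewrite -nneseries_EFin//; apply: eq_eseriesr => i _.
  by rewrite integral_indic// setIT; exact: PE.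
split => //.
have Y2 w : (Y w ^+ 2)%:E = \sum_(0 <= i <oo) ((Y w)%:E * (\1_(E i) w)%:E).
  rewrite nneseriesZl; last by move=> i _; rewrite lee_fin.
  by rewrite YE -EFinM expr2.
under eq_integral do rewrite Y2.
rewrite integral_nneseries//; last 2 first.
- by move=> i; apply: emeasurable_funM => //; exact/measurable_EFinP.
- by move=> i w _; rewrite mule_ge0// lee_fin.
have IE i : \int[P]_w ((Y w)%:E * (\1_(E i) w)%:E) =
    \sum_(0 <= k <oo) P (E i `&` E k).
  have H w : (Y w)%:E * (\1_(E i) w)%:E =
      \sum_(0 <= k <oo) (\1_(E i `&` E k) w : R)%:E.
    rewrite -YE muleC -nneseriesZl; last by move=> k _; rewrite lee_fin.
    by apply: eq_eseriesr => k _; rewrite indicI EFinM.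
  under eq_integral do rewrite H.
  rewrite integral_nneseries//.
  - by apply: eq_eseriesr => k _; rewrite integral_indic ?setIT//; exact: measurableI.
  - by move=> k; apply/measurable_EFinP/measurable_indic; exact: measurableI.
have IEle i : \int[P]_w ((Y w)%:E * (\1_(E i) w)%:E) <= (p i * (1 + m))%:E.
  rewrite IE; apply: (@le_trans _ _
    (\sum_(0 <= k <oo) ((p i)%:E * ((k \in [:: i])%:R : R)%:E + (p i)%:E * (p k)%:E))).
    apply: lee_nneseries => k _ //.
    rewrite -!EFinM -EFinD inE; have [->|ki] := eqVneq k i.
      rewrite setIid PE lee_fin mulr1 lerDl mulr_ge0//.
    by rewrite mulr0 add0r PEE// eq_sym.
  rewrite nneseriesD; last 2 first.
  - by move=> k _ _; rewrite -EFinM lee_fin mulr_ge0.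
  - by move=> k _ _; rewrite -EFinM lee_fin mulr_ge0.
  rewrite !nneseriesZl; last 2 first.
  - by move=> k _; rewrite lee_fin.
  - by move=> k _; rewrite lee_fin.
  by rewrite eseries_mem_size nneseries_EFin// -!EFinM -EFinD mulrDr.
apply: (@le_trans _ _ (\sum_(0 <= i <oo) (p i * (1 + m))%:E)).
  apply: lee_nneseries => i _ //.
  by move=> _; apply: integral_ge0 => w _; rewrite -EFinM lee_fin mulr_ge0.
rewrite (eq_eseriesr (g := fun i => (1 + m)%:E * (p i)%:E)); last first.
  by move=> i _; rewrite -EFinM mulrC.
rewrite nneseriesZl; last by move=> i _; rewrite lee_fin.
by rewrite nneseries_EFin// -EFinM mulrDl mul1r expr2.
Qed.

(** The square is expanded as E (Y-m)^2 + 2m E Y = E Y^2 + m^2, where all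
    integrands are nonnegative. *)
Lemma chebyshev_moments (d : measure_display) (T : measurableType d)
  (R : realType) (P : probability T R) (Y : T -> R) (m t : R) :
  measurable_fun [set: T] Y -> (forall w, (0 <= Y w)%R) -> (0 <= m)%R -> (0 < t)%R ->
  \int[P]_w (Y w)%:E = m%:E -> \int[P]_w (Y w ^+ 2)%:E <= (m + m ^+ 2)%:E ->
  P [set w | (t <= `|Y w - m|)%R] <= (m / t ^+ 2)%:E.
Proof.
move=> mY Y0 m0 t0 IY IY2.
have mD : measurable_fun [set: T] (fun w => `|Y w - m|)%R.
  by apply: measurableT_comp => //; exact: measurable_funB.
set A := [set w | _].
have mA : measurable A.
  rewrite (_ : A = (fun w => `|Y w - m|)%R @^-1` `[t, +oo[); last first.
    by apply/seteqP; split=> w; rewrite /A/= in_itv/= andbT.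
  by rewrite -[X in measurable X]setTI; apply: mD.
have mY2 : measurable_fun [set: T] (fun w => (Y w ^+ 2)%:E).
  exact/measurable_EFinP/measurable_funX.
have mYm2 : measurable_fun [set: T] (fun w => ((Y w - m) ^+ 2)%:E).
  by apply/measurable_EFinP/measurable_funX; exact: measurable_funB.
have key : \int[P]_w ((Y w - m) ^+ 2)%:E + (2 * m ^+ 2)%:E <= (m + 2 * m ^+ 2)%:E.
  have -> : (2 * m ^+ 2)%:E = \int[P]_w ((2 * m)%:E * (Y w)%:E).
    rewrite ge0_integralZl ?IY//; last by rewrite lee_fin mulr_ge0.
    - by rewrite -EFinM -mulrA.
    - exact/measurable_EFinP.
    - by move=> w _; rewrite lee_fin.
  rewrite -ge0_integralD//; last 3 first.
  - by move=> w _; rewrite lee_fin sqr_ge0.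
  - by move=> w _; rewrite -EFinM lee_fin !mulr_ge0.
  - by apply: emeasurable_funM => //; exact/measurable_EFinP.
  rewrite (eq_integral (fun w => (Y w ^+ 2)%:E + (m ^+ 2)%:E)); last first.
    by move=> w _; rewrite -EFinM -!EFinD; congr EFin; ring.
  rewrite ge0_integralD//; last 2 first.
  - by move=> w _; rewrite lee_fin sqr_ge0.
  - by move=> w _; rewrite lee_fin sqr_ge0.
  have ic : \int[P]_w (m ^+ 2)%:E = (m ^+ 2)%:E.
    by rewrite -[RHS]mule1 -(probability_setT P); exact: integral_cst.
  rewrite ic.
  apply: le_trans (leeD2r _ IY2) _.
  by rewrite -EFinD lee_fin; lra.
have vle : \int[P]_w ((Y w - m) ^+ 2)%:E <= m%:E.
  by rewrite -(leeD2rE (x := (2 * m ^+ 2)%:E))// -EFinD.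
have tA : (t ^+ 2)%:E * P A <= \int[P]_w ((Y w - m) ^+ 2)%:E.
  have -> : (t ^+ 2)%:E * P A = \int[P]_w ((t ^+ 2)%:E * (\1_A w)%:E).
    rewrite ge0_integralZl ?integral_indic ?setIT//.
    - exact/measurable_EFinP/measurable_indic.
    - by rewrite lee_fin sqr_ge0.
  apply: ge0_le_integral => //.
  - by move=> w _; rewrite -EFinM lee_fin mulr_ge0// sqr_ge0.
  - by apply: emeasurable_funM => //; exact/measurable_EFinP/measurable_indic.
  - move=> w _; rewrite -EFinM lee_fin indicE.
    have [wA|] := boolP (w \in A); last by rewrite mulr0 sqr_ge0.
    move: wA; rewrite inE /A/= => wA.
    by rewrite mulr1 -[leRHS]real_normK ?num_real// lerXn2r ?nnegrE// ltW.
have := le_trans tA vle.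
have Pfin : P A \is a fin_num by exact: fin_num_measure.
rewrite -(fineK Pfin) -EFinM !lee_fin => h.
by rewrite ler_pdivlMr ?exprn_gt0// mulrC.
Qed.

End second_moment.

(** * The number of different words *)

(** There are countably many possible beginnings of length n, and each one is
    imposed by finitely many conditions X_j = s_j. *)
Lemma measurable_prefix (d : measure_display) (T : measurableType d)
  (R : realType) (P : probability T R) (X : nat -> {RV P >-> nat})
  (Phi : (nat -> nat) -> Prop) (n : nat) :
  (forall x y, (forall j, (j < n)%N -> x j = y j) -> Phi x -> Phi y) ->
  measurable [set w | Phi (fun j => X j w)].
Proof.
move=> loc.
rewrite (_ : [set _ | _] = \bigcup_(s : seq nat)
    ([set w | Phi (nth 0%N s)] `&` \bigcap_(j in `I_n) (X j @^-1` [set nth 0%N s j]))).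
  apply: countable_bigcupT_measurable; first exact: countableP.
  move=> s; apply: measurableI.
    by have [h|h] := pselect (Phi (nth 0%N s));
      [rewrite (_ : mkset _ = setT)|rewrite (_ : mkset _ = set0)] => //;
      apply/seteqP; split.
  apply: fin_bigcap_measurable; first exact: finite_II.
  by move=> j _; rewrite -[X in measurable X]setTI; exact: measurable_funPT.
apply/seteqP; split => w /=.
  move=> Pw; exists (mkseq (fun j => X j w) n) => //; split => /=.
    by apply: loc Pw => j jn; rewrite nth_mkseq.
  by move=> j /= jn; rewrite nth_mkseq.
move=> [s _ [/= Ps H]]; apply: loc Ps => j jn.
by rewrite (H j jn).
Qed.

Lemma eq_nb_words (x y : nat -> nat) (n : nat) :
  (forall j, (j < n)%N -> x j = y j) -> nb_words x n = nb_words y n.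
Proof.
move=> h; congr (size (undup _)); apply/eq_in_map => j.
by rewrite mem_iota => /andP[_ jn]; exact: h.
Qed.

Lemma nb_words_mono (x : nat -> nat) (k n : nat) : (k <= n)%N ->
  (nb_words x k <= nb_words x n)%N.
Proof.
move=> kn; apply: uniq_leq_size; first exact: undup_uniq.
move=> i; rewrite !mem_undup => /mapP[j]; rewrite mem_iota => /andP[_ jk] ->.
by apply/map_f; rewrite mem_iota/=; exact: leq_trans jk kn.
Qed.

Definition word_prob (R : realType) (th q : R) (i : nat) : R :=
  if i is i'.+1 then zipf_mandelbrot th q i'.+1 else 0.

Definition unseen (d : measure_display) (T : measurableType d) (X : nat -> T -> nat)
  (n : nat) (B : set nat) : set T :=
  \big[setI/setT]_(j <- iota 0 n) (X j @^-1` (~` B)).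

Lemma unseenE (d : measure_display) (T : measurableType d) (X : nat -> T -> nat)
  (n : nat) (B : set nat) (w : T) :
  unseen X n B w <-> (forall i, B i -> i \notin [seq X j w | j <- iota 0 n]).
Proof.
rewrite /unseen -bigcap_seq; split.
  move=> H i Bi; apply/negP => /mapP[j jn ij].
  by apply: (H j jn); rewrite /= -ij.
by move=> H j /= jn /= /H /negP; apply; exact: map_f.
Qed.

(** The probabilities of the values i >= 1 already add up to 1. *)
Lemma hypothesisH_word_prob (R : realType) (d : measure_display)
  (T : measurableType d) (P : probability T R) (X : nat -> {RV P >-> nat})
  (th q : R) : hypothesisH X th q ->
  forall j i, P (X j @^-1` [set i]) = (word_prob th q i)%:E.
Proof.
move=> [th01 q1 Pi _] j [|i]; last exact: Pi.
have mX i : measurable (X j @^-1` [set i]).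
  by rewrite -[X in measurable X]setTI; exact: measurable_funPT.
have tr : trivIset setT (fun i => X j @^-1` [set i]).
  apply/trivIsetP => a b _ _ ab; apply/seteqP; split => w //= -[e1 e2];
    by move: ab; rewrite -e1 -e2 eqxx.
have : P (\bigcup_i (X j @^-1` [set i])) = 1%E.
  rewrite -[RHS](probability_setT P); congr (P _).
  by apply/seteqP; split => w // _; exists (X j w).
rewrite measure_bigcup//.
under eq_eseriesl do rewrite in_setT.
rewrite nneseries_recl//.
rewrite -(nneseries_addn (f := fun i => P (X j @^-1` [set i])))//.
under eq_eseriesr => i _ do rewrite addn1 Pi//.
rewrite nneseries_EFin; last exact: is_cvg_zipf.
rewrite lim_zipf//.
have Pfin : P (X j @^-1` [set 0%N]) \is a fin_num by exact: fin_num_measure.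
have aux (z : \bar R) : z \is a fin_num -> (z + 1 = 1 -> z = 0)%E.
  by case: z => [r| |]// _ [h]; congr EFin; lra.
exact: aux.
Qed.

Lemma word_prob_ge0 (R : realType) (th q : R) i : 0 < th < 1 -> -1 < q ->
  0 <= word_prob th q i <= 1.
Proof.
by move=> h q1; case: i => [|i] /=; rewrite ?lexx ?ler01// zipf_ge0// zipf_le1.
Qed.

Lemma prob_unseen (R : realType) (d : measure_display)
  (T : measurableType d) (P : probability T R) (X : nat -> {RV P >-> nat})
  (th q : R) (n : nat) (B : set nat) (b : R) : hypothesisH X th q ->
  (forall j, P (X j @^-1` B) = b%:E) ->
  P (unseen X n B) = ((1 - b) ^+ n)%:E.
Proof.
move=> [_ _ _ ind] PB.
have := ind (iota 0 n) (fun=> ~` B) (iota_uniq _ _) (fun=> I).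
rewrite -/(unseen X n B) => ->.
under eq_bigr => j _.
  rewrite preimage_setC probability_setC; last first.
    by rewrite -[X in measurable X]setTI; exact: measurable_funPT.
  rewrite PB -EFinB.
  over.
rewrite prodEFin big_const_seq count_predT size_iota.
by rewrite iter_mulr_1.
Qed.

Lemma unseenI (d : measure_display) (T : measurableType d) (X : nat -> T -> nat)
  (n : nat) (B C : set nat) : unseen X n B `&` unseen X n C = unseen X n (B `|` C).
Proof.
apply/seteqP; split => w.
  by move=> [/unseenE h1 /unseenE h2]; apply/unseenE => i [/h1|/h2].
by move/unseenE => h; split; apply/unseenE => i ?; apply: h; [left|right].
Qed.

(** Let a and b be the probabilities of two words.  By independence of the
    positions, the probability that neither occurs among n words is (1-a-b)^n,
    at most (1-a)^n (1-b)^n.  So the events that words occur are pairwise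
    negatively correlated and [indicator_sum_moments] applies. *)
Lemma nb_words_chebyshev (R : realType) (d : measure_display)
  (T : measurableType d) (P : probability T R) (X : nat -> {RV P >-> nat})
  (th q : R) (n : nat) (t : R) : hypothesisH X th q -> 0 < t ->
  (P [set w | (t <= `|(nb_words (fun j => X j w) n)%:R - expected_words th q n|)%R]
    <= (expected_words th q n / t ^+ 2)%:E)%E.
Proof.
move=> H t0; have [th01 q1 _ _] := H.
pose E i := ~` unseen X n [set i].
pose p i := 1 - (1 - word_prob th q i) ^+ n.
pose Y w := (nb_words (fun j => X j w) n)%:R : R.
have mU B : measurable (unseen X n B).
  apply: bigsetI_measurable => j _.
  by rewrite -[X in measurable X]setTI; exact: measurable_funPT.
have wp i := @word_prob_ge0 R th q i th01 q1.
have PU i : P (unseen X n [set i]) = ((1 - word_prob th q i) ^+ n)%:E.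
  by apply: (prob_unseen _ H) => j; exact: hypothesisH_word_prob.
have PE i : P (E i) = (p i)%:E by rewrite /E probability_setC// PU.
have p0 i : 0 <= p i by case/andP: (onem_expr_le n (wp i)).
have pS : (fun i => p i.+1) = (fun i => 1 - (1 - zipf_mandelbrot th q i.+1) ^+ n) by [].
have p00 : p 0%N = 0 by rewrite /p /= subr0 expr1n subrr.
have plim : series p @ \oo --> expected_words th q n.
  have := @cvg_series_shift _ p (expected_words th q n).
  by rewrite p00 add0r; apply; rewrite pS; exact: is_cvg_expected_words.
have cp : cvgn (series p) by exact: cvgP plim.
have lp : limn (series p) = expected_words th q n by exact: cvg_lim plim.
have PEE i k : i != k -> (P (E i `&` E k) <= (p i * p k)%:E)%E.
  move=> ik.
  have PXU j : P (X j @^-1` ([set i] `|` [set k])) =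
      (word_prob th q i + word_prob th q k)%:E.
    rewrite preimage_setU measureU.
    - rewrite EFinD; congr (_ + _)%E; exact: (hypothesisH_word_prob H).
    - by rewrite -[X in measurable X]setTI; exact: measurable_funPT.
    - by rewrite -[X in measurable X]setTI; exact: measurable_funPT.
    - by apply/seteqP; split => w //= -[e1 e2]; move: ik; rewrite -e1 -e2 eqxx.
  have PUU : P (unseen X n [set i] `&` unseen X n [set k]) =
      ((1 - (word_prob th q i + word_prob th q k)) ^+ n)%:E.
    by rewrite unseenI; exact: (prob_unseen _ H).
  have ab1 : word_prob th q i + word_prob th q k <= 1.
    rewrite -lee_fin -(PXU 0%N); apply: probability_le1.
    by rewrite -[X in measurable X]setTI; exact: measurable_funPT.
  have -> : E i `&` E k = ~` (unseen X n [set i] `|` unseen X n [set k]).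
    by rewrite setCU.
  have UU : P (unseen X n [set i] `|` unseen X n [set k]) =
      ((1 - word_prob th q i) ^+ n + (1 - word_prob th q k) ^+ n -
       (1 - (word_prob th q i + word_prob th q k)) ^+ n)%:E.
    rewrite EFinB EFinD -!PU -PUU; apply: measureUfinl => //.
    by rewrite ltey_eq fin_num_measure.
  have PC : P (~` (unseen X n [set i] `|` unseen X n [set k])) =
      (1 - ((1 - word_prob th q i) ^+ n + (1 - word_prob th q k) ^+ n -
       (1 - (word_prob th q i + word_prob th q k)) ^+ n))%:E.
    by rewrite EFinB -UU; apply: probability_setC; exact: measurableU.
  rewrite PC lee_fin /p.
  case/andP: (wp i) => a0 a1; case/andP: (wp k) => b0 b1.
  set a := word_prob th q i in ab1 a0 a1 *; set b := word_prob th q k in ab1 b0 b1 *.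
  have : (1 - (a + b)) ^+ n <= ((1 - a) * (1 - b)) ^+ n.
    have ab0 : 0 <= a * b by exact: mulr_ge0.
    apply: lerXn2r; rewrite ?nnegrE; [lra|apply: mulr_ge0; lra|lra].
  rewrite exprMn; lra.
have mY : measurable_fun [set: T] Y.
  move=> _ B _; rewrite setTI.
  apply: (@measurable_prefix _ _ _ P X (fun x => B (nb_words x n)%:R) n).
  by move=> x y xy; rewrite (eq_nb_words xy).
have Y0 w : 0 <= Y w by [].
have YE w : (\sum_(0 <= i <oo) (\1_(E i) w : R)%:E = (Y w)%:E)%E.
  rewrite /Y /nb_words -eseries_mem_size; apply: eq_eseriesr => i _.
  rewrite indicE; congr ((_ : bool)%:R%:E).
  apply/idP/idP; rewrite inE /E/=.
    move=> h; apply/negPn/negP => /negP iN; apply: h; apply/unseenE => _ ->.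
    exact/negP.
  by move=> h /unseenE/(_ i erefl); rewrite h.
have mE i : measurable (E i) by apply: measurableC.
have [I1 I2] := indicator_sum_moments mE p0 cp PE PEE mY Y0 YE.
move: I1 I2; rewrite lp => I1 I2.
apply: chebyshev_moments => //.
by rewrite -lp; exact: lim_series_ge0.
Qed.

(** * The estimators on a text whose counts follow their means *)

Lemma near_powR_ge (R : realType) (c M : R) : 0 < c ->
  \forall n \near \oo, M <= n%:R `^ c.
Proof.
move=> c0; near=> n.
have n1 : Num.max M 1 `^ c^-1 <= n%:R by near: n; exact: nbhs_infty_ger.
have M1 : 0 <= Num.max M 1 by rewrite le_max ler01 orbT.
apply: (@le_trans _ _ (Num.max M 1)); first by rewrite le_max lexx.
have -> : Num.max M 1 = (Num.max M 1 `^ c^-1) `^ c.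
  by rewrite -powRrM mulVf ?gt_eqF// powRr1.
apply: ge0_ler_powR; rewrite ?nnegrE ?powR_ge0//; exact: ltW.
Unshelve. all: by end_near. Qed.

Lemma expected_words_mono (R : realType) (th q : R) (k n : nat) :
  0 < th < 1 -> -1 < q -> (k <= n)%N ->
  expected_words th q k <= expected_words th q n.
Proof.
move=> h q1 kn; apply: lim_series_le; try exact: is_cvg_expected_words.
move=> i; rewrite lerD2l lerN2; apply: ler_wiXn2l => //.
  by rewrite subr_ge0 zipf_le1.
by rewrite gerBl zipf_ge0.
Qed.

Lemma expected_words1 (R : realType) (th q : R) : 0 < th < 1 -> -1 < q ->
  expected_words th q 1 = 1.
Proof.
move=> h q1; rewrite -[RHS](lim_zipf h q1) /expected_words.
congr (limn (series _)); apply/funext => i.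
by rewrite expr1 opprB addrC subrK.
Qed.

(** The case k = 1 of [expected_words_lin], where r(1) = 1. *)
Lemma expected_words_le_pow (R : realType) (th q : R) (n : nat) :
  0 < th < 1 -> -1 < q -> (0 < n)%N ->
  expected_words th q n <= (2 * q + 8) * n%:R `^ th.
Proof.
move=> h q1 n0; have n0' : 0 < n%:R :> R by rewrite ltr0n.
have := expected_words_lin h q1 n0 n0.
rewrite expected_words1//.
have -> : (1%:R / n%:R) `^ th = (n%:R `^ th)^-1.
  by rewrite div1r -powR_inv1// -powRrM mulN1r powRN.
rewrite ler_distlC => /andP[_].
have := powR_gt0 th n0'; set x := _ `^ _ => x0 h1.
rewrite -ler_pdivrMr// mulrC; lra.
Qed.

Lemma powR_div_le (R : realType) (n x y c : R) : 0 <= n -> 0 < x -> x <= y ->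
  0 <= c -> n `^ c / y `^ c <= (n / x) `^ c.
Proof.
move=> n0 x0 xy c0; have y0 := lt_le_trans x0 xy.
rewrite powRM ?invr_ge0 ?(ltW x0)// ler_wpM2l ?powR_ge0//.
rewrite -[x^-1]powR_inv1 ?(ltW x0)// powRAC powR_inv1 ?powR_ge0//.
rewrite lef_pV2 ?posrE ?powR_gt0//.
by apply: ge0_ler_powR; rewrite ?nnegrE ?(ltW x0) ?(ltW y0).
Qed.

(** In [expected_words_ge_pow] the zeta value is largest at q = a and the term
    q+1, at most b+1, is absorbed for large n: the constant depends on the
    segment only. *)
Lemma expected_words_ge_uniform (R : realType) (th a b : R) :
  0 < th < 1 -> -1 < a -> a <= b ->
  exists2 K : R, 0 < K & \forall n \near \oo, forall q, a <= q <= b ->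
    K * n%:R `^ th <= expected_words th q n.
Proof.
move=> h a1 ab; have /andP[th0 th1] := h.
have al1 : 1 < th^-1 by rewrite invf_gt1.
have a0 : 0 < a + 1 by lra.
have z0 := hurwitz_gt0 al1 a0.
pose z := hurwitz_zeta th^-1 (a + 1) `^ th.
have zz0 : 0 < z by exact: powR_gt0.
exists (z^-1 / 4); first by rewrite divr_gt0// invr_gt0.
near=> n => q /andP[aq qb].
have q1 : -1 < q by lra.
have := expected_words_ge_pow n h q1.
have h1 : n%:R `^ th / z <= (n%:R / hurwitz_zeta th^-1 (q + 1)) `^ th.
  have zq0 : 0 < hurwitz_zeta th^-1 (q + 1) by apply: hurwitz_gt0 => //; lra.
  apply: powR_div_le => //; last exact: ltW.
  by apply: hurwitz_nonincr => //; lra.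
have h2 : (b + 1) * z * 2 <= n%:R `^ th by near: n; exact: near_powR_ge.
have : b + 1 <= n%:R `^ th / z / 2.
  by rewrite ler_pdivlMr// ler_pdivlMr// -mulrA (mulrC 2) mulrA.
rewrite mulrAC [_^-1 * _]mulrC.
lra.
Unshelve. all: by end_near. Qed.

Lemma sup_le_nonneg (R : realType) (S : set R) (e : R) : 0 <= e ->
  (forall x, S x -> x <= e) -> sup S <= e.
Proof.
move=> e0 Se; have [->|/set0P S0] := eqVneq S set0; first by rewrite sup0.
by apply: ge_sup => // x; exact: Se.
Qed.

Lemma sup_nonneg (R : realType) (S : set R) : (forall x, S x -> 0 <= x) -> 0 <= sup S.
Proof.
move=> S0; have [[[x Sx] ub]|ns] := pselect (has_sup S); last by rewrite sup_out.
by apply: le_trans (S0 _ Sx) _; exact: ub_le_sup.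
Qed.

Lemma unif_dist01_ge0 (R : realType) (f g : R -> R) : 0 <= unif_dist01 f g.
Proof. by apply: sup_nonneg => _ [t _ <-]. Qed.

Lemma truncn_mul_le (R : realType) (n : nat) (t : R) : t <= 1 ->
  (Num.truncn (n%:R * t) <= n)%N.
Proof.
move=> t1; have [t0|t0] := leP 0 t; last first.
  suff -> : Num.truncn (n%:R * t) = 0%N by [].
  apply/eqP; rewrite -leqn0 leqNgt truncn_gt0 -ltNge.
  by apply: le_lt_trans ltr01; rewrite mulr_ge0_le0// ltW.
rewrite -(ler_nat R) (@le_trans _ _ (n%:R * t))//.
  by rewrite truncn_le mulr_ge0.
by rewrite ler_piMr.
Qed.

Lemma unif_dist01_interpolation (R : realType) (n : nat) (f g : nat -> R) (e : R) :
  0 <= e -> (forall k, (k <= n)%N -> `|f k - g k| <= e) ->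
  unif_dist01 (interpolation n f) (interpolation n g) <= e.
Proof.
move=> e0 fg; apply: sup_le_nonneg => // _ [t /= + <-].
rewrite in_itv/= => /andP[t0 t1]; rewrite /interpolation.
have nt0 : 0 <= n%:R * t by rewrite mulr_ge0.
have kn := truncn_mul_le n t1.
have /andP[kt tk] := truncn_itv nt0.
set k := Num.truncn _ in kn kt tk *.
set u := n%:R * t - k%:R.
have u0 : 0 <= u by rewrite subr_ge0.
have u1 : u <= 1 by rewrite lerBlDl natr1 ltW.
have -> : f k + u * (f k.+1 - f k) - (g k + u * (g k.+1 - g k)) =
    (1 - u) * (f k - g k) + u * (f k.+1 - g k.+1) by ring.
apply: le_trans (ler_normD _ _) _; rewrite !normrM.
rewrite (ger0_norm u0) ger0_norm ?subr_ge0//.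
have h1 : (1 - u) * `|f k - g k| <= (1 - u) * e.
  by rewrite ler_wpM2l ?subr_ge0// fg.
have h2 : u * `|f k.+1 - g k.+1| <= u * e.
  have [kn'|nk] := ltnP k n; first by rewrite ler_wpM2l// fg.
  (* Here k = n, so the value at n+1 has weight zero. *)
  have -> : u = 0; last by rewrite !mul0r.
  apply/eqP; rewrite eq_le u0 andbT subr_le0.
  apply: (@le_trans _ _ n%:R); first by rewrite ler_piMr.
  by rewrite ler_nat.
lra.
Qed.

(** The counts R_k cancel in the difference of the processes, and R_n = r(n)
    leaves the quantity bounded by [expected_words_lin]. *)
Lemma Z_dist_le (R : realType) (A : R -> R) (x : nat -> nat) (n : nat) (qh : R) :
  (0 < n)%N -> is_q_hat A x n qh ->
  unif_dist01 (Z_hat A x n) (Z_tilde A x n qh) <=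
  (2 * qh + 7) / Num.sqrt (nb_words x n)%:R.
Proof.
move=> n0 [th01 q1 rn].
apply: unif_dist01_interpolation; first by rewrite divr_ge0 ?sqrtr_ge0//; lra.
move=> k kn; rewrite -mulrBl normrM normfV (ger0_norm (sqrtr_ge0 _)).
rewrite ler_wpM2r ?invr_ge0 ?sqrtr_ge0//.
have := expected_words_lin th01 q1 kn n0; rewrite rn.
set v := _ `^ _ * _; set r := expected_words _ _ _.
by have -> : (nb_words x k)%:R - v - ((nb_words x k)%:R - r) = r - v by ring.
Qed.

Lemma powR_split (R : realType) (x c : R) : 0 < x -> x = x `^ c * x `^ (1 - c).
Proof.
move=> x0; rewrite -powRD; last by rewrite (gt_eqF x0) implybT.
by rewrite (_ : c + (1 - c) = 1) ?powRr1 ?ltW//; ring.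
Qed.

(** [expected_words_ge_pow], with zeta(1/th,Q) <= Q^(1-1/th) / (1-th) for
    Q = q+1 >= 1 and (1-th)^th >= 1-th. *)
Lemma q_hat_pow_le (R : realType) (th q : R) (n : nat) :
  0 < th < 1 -> 0 <= q ->
  (1 - th) * n%:R `^ th * (q + 1) `^ (1 - th) <=
  2 * expected_words th q n + (q + 1).
Proof.
move=> h q0; have /andP[th0 th1] := h.
have q1 : -1 < q by lra.
apply: le_trans (expected_words_ge_pow n h q1).
have al1 : 1 < th^-1 by rewrite invf_gt1.
have Q0 : 0 < q + 1 by lra.
have Q1 : 1 <= q + 1 by lra.
have z0 := hurwitz_gt0 al1 Q0; have := hurwitz_le al1 Q0.
move: (hurwitz_zeta _ _) z0 => z z0 zle.
pose y := (q + 1) `^ (- (th^-1 - 1)) / (1 - th).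
have zy : z <= y.
  apply: le_trans zle _.
  have : (q + 1) `^ (- th^-1) <= (q + 1) `^ (- (th^-1 - 1)) by apply: ler_powR; lra.
  rewrite /y; set w := _ `^ (- (_ - _)) => hw.
  have -> : w / (1 - th) = w + w / (th^-1 - 1); last by rewrite lerD2r.
  by field; rewrite !gt_eqF ?subr_gt0 ?invf_gt1//; lra.
apply: le_trans (powR_div_le (ler0n _ n) z0 zy (ltW th0)).
have -> : y `^ th = ((q + 1) `^ (1 - th))^-1 * ((1 - th) `^ th)^-1.
  rewrite /y powRM ?powR_ge0 ?invr_ge0//; last by lra.
  rewrite -powRrM -powRN; congr (_ `^ _ * _).
    by field; rewrite gt_eqF.
  by rewrite -[_^-1]powR_inv1 ?subr_ge0 ?(ltW th1)// powRAC powR_inv1 ?powR_ge0.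
rewrite invfM !invrK mulrC mulrA -mulrA [leRHS]mulrC -mulrA.
rewrite ler_wpM2l ?powR_ge0// ler_wpM2r ?powR_ge0//.
by apply: ger1_powR; lra.
Qed.

(** If at least half of the n words are repetitions on average, the distribution
    cannot be spread out: in n Q <= r (Q + (1/th-1) n) the term r Q is at most
    n Q / 2. *)
Lemma q_hat_ge_lin (R : realType) (th q : R) (n : nat) :
  0 < th < 1 -> -1 < q -> (0 < n)%N -> 2 * expected_words th q n <= n%:R ->
  q + 1 <= 2 * expected_words th q n / th.
Proof.
move=> h q1 n0 rn; have /andP[th0 th1] := h.
have := expected_words_ge_q n h q1.
have r0 : 0 <= expected_words th q n.
  apply: lim_series_ge0; last exact: is_cvg_expected_words.
  move=> i; have := @onem_expr_le R (zipf_mandelbrot th q i.+1) n.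
  by rewrite zipf_ge0 ?zipf_le1// => /(_ isT)/andP[].
set r := expected_words _ _ _ in rn r0 *.
have n0' : 0 < n%:R :> R by rewrite ltr0n.
have Q0 : 0 < q + 1 by lra.
have h1 : 2 * r * (q + 1) <= n%:R * (q + 1) by rewrite ler_wpM2r// ltW.
move=> h2; rewrite -(ler_pM2l n0').
have h3 : n%:R * (q + 1) <= 2 * r * ((th^-1 - 1) * n%:R) by lra.
apply: le_trans h3 _.
have : 0 <= r * n%:R by rewrite mulr_ge0// ltW.
lra.
Qed.

(** Let Q = qh+1.  Once Q is below a small multiple of n, the term Q on the right
    of [q_hat_pow_le] is at most half of the left side, because
    Q = Q^th' Q^(1-th').  Then n^th' Q^(1-th') = O(n^th).  With
    |th' - th| <= tau = th (1-th) / 8 this gives Q^((1-th)/2) = O(n^tau), and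
    tau * 2/(1-th) = th/4. *)
Lemma q_hat_growth (R : realType) (th th' K qh : R) (n : nat) :
  0 < th < 1 -> 0 < th' < 1 -> 0 < K -> (0 < n)%N -> 0 <= qh ->
  `|th' - th| <= th * (1 - th) / 8 ->
  expected_words th' qh n <= K * n%:R `^ th ->
  qh + 1 <= ((1 - th) / 4) `^ (2 / th) * n%:R ->
  qh + 1 <= (8 * K / (1 - th)) `^ (2 / (1 - th)) * n%:R `^ (th / 4).
Proof.
move=> /andP[th0 th1] th'01 K0 n0 qh0 htau Rn2 Qe0.
have onem : 0 < 1 - th by lra.
set tau := th * (1 - th) / 8 in htau.
have [tau1 tau2] : tau <= th / 8 /\ tau <= (1 - th) / 8.
  by split; rewrite ler_pM2r ?invr_gt0// ?ger_pMr ?ger_pMl//; lra.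
have [htau1 htau2] : th - tau <= th' /\ th' <= th + tau.
  by move: htau; rewrite ler_distl => /andP[].
have th'half : th / 2 <= th' by lra.
have onem'half : (1 - th) / 2 <= 1 - th' by lra.
have onem4 : (1 - th) / 4 <= (1 - th') / 2 by lra.
clear htau tau1 tau2 htau2.
set e0 := _ `^ (2 / th) in Qe0.
have e00 : 0 < e0 by apply: powR_gt0; rewrite divr_gt0.
have e01 : e0 <= 1.
  have -> : 1 = 1 `^ (2 / th) by rewrite powR1.
  by apply: ge0_ler_powR; rewrite ?nnegrE ?divr_ge0 ?ltW//; lra.
set C2 := 8 * K / (1 - th); set C3 := C2 `^ _.
have C20 : 0 < C2 by rewrite divr_gt0 ?mulr_gt0.
have n0' : 0 < n%:R :> R by rewrite ltr0n.
have n1 : 1 <= n%:R :> R by rewrite ler1n.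
have Q1 : 1 <= qh + 1 by rewrite lerDr.
have Q0 : 0 < qh + 1 by apply: lt_le_trans Q1.
have Qth' : (qh + 1) `^ th' <= (1 - th') / 2 * n%:R `^ th'.
  apply: (@le_trans _ _ (e0 `^ th' * n%:R `^ th')).
    rewrite -powRM ?(ltW e00)//; apply: ge0_ler_powR; rewrite ?nnegrE//.
    - by case/andP: th'01 => /ltW.
    - exact: ltW.
    - by rewrite mulr_ge0// ltW.
  apply: ler_wpM2r; first exact: powR_ge0.
  (* The multiple e0 = ((1-th)/4)^(2/th) is chosen so that
     e0^th' <= e0^(th/2) = (1-th)/4 <= (1-th')/2. *)
  apply: (@le_trans _ _ (e0 `^ (th / 2))).
    by apply: ger_powR => //; rewrite e00.
  rewrite /e0 -powRrM (_ : 2 / th * (th / 2) = 1); last by field; rewrite gt_eqF.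
  by rewrite powRr1//; lra.
have QE : qh + 1 = (qh + 1) `^ th' * (qh + 1) `^ (1 - th').
  exact: powR_split.
have p0 : 0 <= (qh + 1) `^ (1 - th') by exact: powR_ge0.
have B1 : (1 - th') * n%:R `^ th' * (qh + 1) `^ (1 - th') <= 4 * (K * n%:R `^ th).
  have := q_hat_pow_le n th'01 qh0.
  have : qh + 1 <= (1 - th') / 2 * n%:R `^ th' * (qh + 1) `^ (1 - th').
    by rewrite {1}QE ler_wpM2r.
  by move: Rn2; lra.
have B2 : n%:R `^ (th - tau) * (qh + 1) `^ ((1 - th) / 2) <= C2 * n%:R `^ th.
  have le1 : n%:R `^ (th - tau) <= n%:R `^ th' by apply: ler_powR.
  have le2 : (qh + 1) `^ ((1 - th) / 2) <= (qh + 1) `^ (1 - th').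
    exact: ler_powR.
  have : n%:R `^ (th - tau) * (qh + 1) `^ ((1 - th) / 2) <=
         n%:R `^ th' * (qh + 1) `^ (1 - th') by apply: ler_pM; rewrite ?powR_ge0.
  move/le_trans; apply.
  have -> : C2 * n%:R `^ th = 4 * (K * n%:R `^ th) / ((1 - th) / 2).
    by rewrite /C2; field; rewrite gt_eqF.
  rewrite ler_pdivlMr ?divr_gt0//.
  apply: le_trans B1; rewrite mulrC -mulrA ler_wpM2r// mulr_ge0// powR_ge0//.
have B3 : (qh + 1) `^ ((1 - th) / 2) <= C2 * n%:R `^ tau.
  have ntt : 0 < n%:R `^ (th - tau) by exact: powR_gt0.
  rewrite -(ler_pM2l ntt) (le_trans B2)// mulrCA -powRD ?subrK//.
  by rewrite (gt_eqF n0') implybT.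
have B4 : qh + 1 <= C3 * n%:R `^ (th / 4).
  have -> : qh + 1 = ((qh + 1) `^ ((1 - th) / 2)) `^ (2 / (1 - th)).
    rewrite -powRrM (_ : (1 - th) / 2 * (2 / (1 - th)) = 1) ?powRr1 ?(ltW Q0)//.
    by field; rewrite gt_eqF.
  have -> : C3 * n%:R `^ (th / 4) = (C2 * n%:R `^ tau) `^ (2 / (1 - th)).
    rewrite powRM ?powR_ge0 ?(ltW C20)// -powRrM; congr (_ * _ `^ _).
    by rewrite /tau; field; rewrite gt_eqF.
  apply: ge0_ler_powR; last exact: B3.
  - by rewrite divr_ge0// ltW.
  - by rewrite nnegrE powR_ge0.
  - by rewrite nnegrE; apply: mulr_ge0; [exact: ltW|exact: powR_ge0].
exact: B4.
Qed.

(** A deterministic statement: as soon as R_n is of order n^th and the estimator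
    is close to th, the equation r(n) = R_n is solvable because 1 < R_n < n, and
    every solution is O(n^(th/4)), whereas sqrt R_n is of order n^(th/2). *)
Lemma good_of_counts (R : realType) (A : R -> R) (th K1 K2 eps : R) :
  0 < th < 1 -> 0 < K1 -> 0 < K2 -> 0 < eps ->
  \forall n \near \oo, forall x,
    K1 * n%:R `^ th <= (nb_words x n)%:R <= K2 * n%:R `^ th ->
    `|theta_hat A x n - th| <= th * (1 - th) / 8 ->
    (exists qh, is_q_hat A x n qh) /\
    (forall qh, is_q_hat A x n qh ->
       unif_dist01 (Z_hat A x n) (Z_tilde A x n qh) <= eps).
Proof.
move=> h K10 K20 eps0; have /andP[th0 th1] := h.
pose tau := th * (1 - th) / 8.
have tau0 : 0 < tau by rewrite divr_gt0// mulr_gt0//; lra.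
have tau1 : tau <= th / 8 by rewrite ler_pM2r ?invr_gt0// ger_pMr//; lra.
have tau2 : tau <= (1 - th) / 8 by rewrite ler_pM2r ?invr_gt0// ger_pMl//; lra.
pose C1 := 4 * K2 / th.
pose e0 := ((1 - th) / 4) `^ (2 / th).
have e00 : 0 < e0 by apply: powR_gt0; lra.
have e01 : e0 <= 1.
  have -> : 1 = 1 `^ (2 / th) by rewrite powR1.
  apply: ge0_ler_powR; rewrite ?nnegrE; try lra.
  by rewrite divr_ge0// ltW.
pose C2 := 8 * K2 / (1 - th).
have C20 : 0 < C2 by rewrite divr_gt0 ?mulr_gt0//; lra.
pose C3 := C2 `^ (2 / (1 - th)).
have C30 : 0 <= C3 by exact: powR_ge0.
have onem : 0 < 1 - th by lra.
have sK1 : 0 < Num.sqrt K1 by rewrite sqrtr_gt0.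
have th40 : 0 < th / 4 by rewrite divr_gt0.
near=> n.
have yb : (2 * C3 + 7) / (eps * Num.sqrt K1) <= n%:R `^ (th / 4).
  by near: n; exact: near_powR_ge.
move=> x /andP[Rn1 Rn2].
rewrite -/tau => htau.
set th' := theta_hat A x n in htau *.
set Rn := nb_words x n in Rn1 Rn2 *.
have n0 : (0 < n)%N by near: n; exact: nbhs_infty_gt.
have n0' : 0 < n%:R :> R by rewrite ltr0n.
have n1 : 1 <= n%:R :> R by rewrite ler1n.
have nth0 : 0 < n%:R `^ th by exact: powR_gt0.
have nE : n%:R = n%:R `^ th * n%:R `^ (1 - th).
  exact: powR_split.
have [htau1 htau2] : th - tau <= th' /\ th' <= th + tau.
  by move: htau; rewrite ler_distl => /andP[].
have th'01 : 0 < th' < 1 by lra.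
have th'half : th / 2 <= th' by lra.
have onem'half : (1 - th) / 2 <= 1 - th' by lra.
have R2 : 2 <= Rn%:R :> R.
  apply: le_trans Rn1; rewrite mulrC -ler_pdivrMr//.
  by near: n; exact: near_powR_ge.
have Rhalf : 2 * Rn%:R < n%:R :> R.
  have h1 : 2 * K2 + 1 <= n%:R `^ (1 - th) by near: n; exact: near_powR_ge.
  have : n%:R `^ th * (2 * K2 + 1) <= n%:R by rewrite [leRHS]nE ler_pM2l.
  lra.
split.
  have Rn_gt1 : (1 < Rn)%N by rewrite -(ler_nat R).
  have Rn_ltn : (Rn < n)%N by rewrite -(ltr_nat R); lra.
  have [q q1 rq] := expected_words_onto th'01 Rn_gt1 Rn_ltn.
  by exists q.
move=> qh hq; have [_ q1 rn] := hq.
apply: le_trans (Z_dist_le n0 hq) _; rewrite -/Rn.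
rewrite -/th' -/Rn in rn.
pose y := n%:R `^ (th / 4).
have y1 : 1 <= y.
  have -> : 1 = 1 `^ (th / 4) by rewrite powR1.
  apply: ge0_ler_powR; rewrite ?nnegrE//; lra.
have yth : n%:R `^ th = (y ^+ 2) ^+ 2.
  by rewrite -exprM -powR_mulrn ?powR_ge0// -powRrM; congr (_ `^ _); field.
have sq : Num.sqrt K1 * y ^+ 2 <= Num.sqrt Rn%:R.
  rewrite -[y ^+ 2]ger0_norm ?sqr_ge0// -sqrtr_sqr -sqrtrM ?(ltW K10)//.
  by rewrite -yth ler_sqrt.
have Qy : qh + 1 <= (C3 + 1) * y.
  have [Q1|Q1] := leP (qh + 1) 1; first by rewrite (le_trans Q1)// mulr_ege1//; lra.
  have Q0 : 0 < qh + 1 by lra.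
  have qh0 : 0 <= qh by lra.
  have QC1 : qh + 1 <= C1 * n%:R `^ th.
    apply: le_trans (q_hat_ge_lin th'01 q1 n0 _) _; rewrite rn; first exact: ltW.
    rewrite ler_pdivrMr; last by lra.
    have -> : C1 * n%:R `^ th * th' = 4 * (K2 * n%:R `^ th) * (th' / th).
      by rewrite /C1; field; rewrite gt_eqF.
    apply: (@le_trans _ _ (4 * (K2 * n%:R `^ th) * 2^-1)); first by move: Rn2; lra.
    rewrite ler_wpM2l ?mulr_ge0 ?powR_ge0 ?(ltW K20)//.
    by rewrite ler_pdivlMr// mulrC.
  have Qe0 : qh + 1 <= e0 * n%:R.
    apply: le_trans QC1 _; rewrite [X in _ <= _ * X]nE mulrCA mulrC ler_pM2l//.
    rewrite mulrC -ler_pdivrMr//; near: n; exact: near_powR_ge.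
  have rle : expected_words th' qh n <= K2 * n%:R `^ th by rewrite rn.
  have B4 := q_hat_growth h th'01 K20 n0 qh0 htau rle Qe0.
  by apply: le_trans B4 _; rewrite ler_wpM2r ?lerDl// (le_trans ler01).
have sR : 0 < Num.sqrt Rn%:R :> R by rewrite sqrtr_gt0; lra.
rewrite ler_pdivrMr//.
have : (2 * C3 + 7) * y <= eps * (Num.sqrt K1 * y ^+ 2).
  rewrite expr2 !mulrA ler_wpM2r//; first by lra.
  by rewrite [leRHS]mulrC -ler_pdivrMr ?mulr_gt0.
have : eps * (Num.sqrt K1 * y ^+ 2) <= eps * Num.sqrt Rn%:R by rewrite ler_wpM2l// ltW.
lra.
Unshelve. all: by end_near. Qed.

(** * Consistency of the estimator of the exponent *)

(** As [ln 0] is 0, the truncation in [logp] has no effect on integers. *)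
Lemma logp_nat (R : realType) (k : nat) : logp (k%:R : R) = ln k%:R.
Proof.
rewrite /logp max_l//; case: k => [|k]; first by rewrite ln0.
by apply: ln_ge0; rewrite ler1n.
Qed.

Lemma ler_norm_ln (R : realType) (y r : R) : 0 <= r <= 8^-1 ->
  1 - 4 * r <= y <= 1 + 4 * r -> `|ln y| <= 8 * r.
Proof.
move=> /andP[r0 r1] /andP[y1 y2]; have y0 : 0 < y by lra.
have ln_le (z : R) : 0 < z -> ln z <= z - 1.
  move=> z0; rewrite -{1}(subrK 1 z) addrC; apply: le_ln1Dx; lra.
rewrite ler_norml; apply/andP; split; last by have := ln_le _ y0; lra.
rewrite lerNl -lnV ?posrE//; apply: le_trans (ln_le _ _) _; first by rewrite invr_gt0.
rewrite lerBlDr -[y^-1]mul1r ler_pdivrMr//.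
have : (8 * r + 1) * (1 - 4 * r) <= (8 * r + 1) * y by rewrite ler_wpM2l//; lra.
have : r * r <= r * 8^-1 by rewrite ler_wpM2l.
lra.
Qed.

(** Three relative errors of order rho: k/n is at least (1-rho) t, so (k/n)^th
    is t^th up to the factor 1-rho; m_k is (k/n)^th m up to C, a fraction rho of
    t^th m; and R_k is m_k up to the fraction rho.  For rho <= 1/8 they combine
    to at most 4 rho. *)
Lemma count_ratio (R : realType) (th t m mk Rk C rho : R) (k n : nat) :
  0 < th < 1 -> (0 < n)%N -> 0 < t <= 1 -> 0 < rho <= 8^-1 -> 0 < m ->
  k%:R <= n%:R * t < k%:R + 1 -> 1 <= rho * (n%:R * t) ->
  `|mk - (k%:R / n%:R) `^ th * m| <= C -> C <= rho * (t `^ th * m) ->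
  `|Rk - mk| <= rho * mk ->
  1 - 4 * rho <= Rk / (t `^ th * m) <= 1 + 4 * rho.
Proof.
move=> /andP[th0 th1] n0 /andP[t0 t1] /andP[r0 r1] m0 /andP[kt tk] nt mkC Cm Rmk.
have n0' : 0 < n%:R :> R by rewrite ltr0n.
have tth : 0 < t `^ th by exact: powR_gt0.
have kn0 : 0 <= k%:R / n%:R :> R by rewrite divr_ge0.
have u1 : (k%:R / n%:R) `^ th <= t `^ th.
  apply: ge0_ler_powR; rewrite ?nnegrE ?(ltW th0) ?(ltW t0)//.
  by rewrite ler_pdivrMr// mulrC.
have u2 : (1 - rho) * t `^ th <= (k%:R / n%:R) `^ th.
  apply: (@le_trans _ _ (((1 - rho) * t) `^ th)).
    rewrite powRM ?(ltW t0) ?subr_ge0//; last by lra.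
    by rewrite ler_wpM2r ?(ltW tth)// ger1_powR//; lra.
  apply: ge0_ler_powR; rewrite ?nnegrE ?(ltW th0)//.
    by rewrite mulr_ge0 ?(ltW t0)//; lra.
  rewrite ler_pdivlMr//; lra.
set M := t `^ th * m in Cm *.
have M0 : 0 < M by rewrite mulr_gt0.
have v1 : (k%:R / n%:R) `^ th * m <= M by rewrite ler_wpM2r ?(ltW m0).
have v2 : (1 - rho) * M <= (k%:R / n%:R) `^ th * m.
  by rewrite mulrA ler_wpM2r ?(ltW m0).
move: mkC; rewrite ler_distl => /andP[w1 w2].
move: Rmk; rewrite ler_distl => /andP[z1 z2].
set w := _ `^ _ * m in v1 v2 w1 w2.
clearbody w M; clear u1 u2 kt tk nt.
have x1 : mk <= (1 + rho) * M by lra.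
have x2 : (1 - 2 * rho) * M <= mk by lra.
rewrite ler_pdivlMr// ler_pdivrMr//; apply/andP; split.
  have r2 : 0 <= rho * rho * M by rewrite !mulr_ge0// ltW.
  have h : (1 - rho) * ((1 - 2 * rho) * M) <= (1 - rho) * mk by rewrite ler_wpM2l//; lra.
  lra.
have h : (1 + rho) * mk <= (1 + rho) * ((1 + rho) * M) by rewrite ler_wpM2l//; lra.
have r2 : rho * (rho * M) <= rho * M * 8^-1.
  by rewrite [leRHS]mulrC ler_wpM2r// mulr_ge0 // ltW.
have : 0 < rho * M by rewrite mulr_gt0.
lra.
Qed.

(** For t in [delta,1] the integrand log R_[nt] is within 8 rho of
    th log t + log E R_n, by [count_ratio], and dA kills the constant log E R_n. *)
Lemma theta_hat_consistent (R : realType) (A : R -> R) (th a b tau : R) :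
  admissible A -> 0 < th < 1 -> -1 < a -> a <= b -> 0 < tau ->
  exists rho delta : R, [/\ 0 < rho <= 8^-1, 0 < delta < 1 &
    \forall n \near \oo, forall (q : R) (x : nat -> nat), a <= q <= b ->
    (forall k : nat, n%:R * delta - 1 <= k%:R ->
      `|(nb_words x k)%:R - expected_words th q k| <= rho * expected_words th q k) ->
    `|theta_hat A x n - th| <= tau].
Proof.
move=> hA h a1 ab tau0; have /andP[th0 th1] := h.
have [delta [V [d01 V0 HV]]] := stieltjes01_near hA.
have /andP[d0 d1] := d01.
have [K1 K10 hK1] := expected_words_ge_uniform h a1 ab.
pose C := 2 * b + 7.
have C0 : 0 <= C by rewrite /C; lra.
(* V is the total variation of dA; this choice makes V * (8 * rho) <= tau. *)
pose rho := Num.min 8^-1 (tau / (8 * (V + 1))).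
have V80 : 0 < 8 * (V + 1) by lra.
have r0 : 0 < rho by rewrite lt_min invr_gt0 ltr0n/= divr_gt0.
have r8 : rho <= 8^-1 by rewrite ge_min lexx.
have rV : V * (8 * rho) <= tau.
  have : rho <= tau / (8 * (V + 1)) by rewrite ge_min lexx orbT.
  rewrite ler_pdivlMr// => rr; apply: le_trans rr; lra.
exists rho, delta; split => //; first by rewrite r0.
have dth : 0 < delta `^ th by exact: powR_gt0.
near=> n.
have Kn : forall q, a <= q <= b -> K1 * n%:R `^ th <= expected_words th q n.
  by near: n.
have Cn : C / (rho * delta `^ th * K1) <= n%:R `^ th.
  by near: n; exact: near_powR_ge.
have rn : (rho * delta)^-1 <= n%:R by near: n; exact: nbhs_infty_ger.
have n0 : (0 < n)%N by near: n; exact: nbhs_infty_gt.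
move=> q x qab close.
have n0' : 0 < n%:R :> R by rewrite ltr0n.
set m := expected_words th q n in Kn *.
have q1 : -1 < q by case/andP: qab; lra.
have mK := Kn q qab; rewrite -/m in mK.
have m0 : 0 < m by apply: lt_le_trans mK; rewrite mulr_gt0// powR_gt0.
pose hx (t : R) : R := logp (nb_words x (Num.truncn (n%:R * t)))%:R.
have hmono : {homo hx : s t / s <= t}.
  move=> s t st; rewrite /hx !logp_nat.
  have : (nb_words x (Num.truncn (n%:R * s)) <= nb_words x (Num.truncn (n%:R * t)))%N.
    by apply/nb_words_mono/le_truncn; rewrite ler_wpM2l.
  case: (nb_words x (Num.truncn (n%:R * s))) => [|i] ij.
    rewrite ln0// -logp_nat /logp le_max lexx orbT//.
  by rewrite ler_ln ?posrE ?ltr0n ?(leq_ltn_trans _ ij)// ler_nat.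
apply: le_trans rV; rewrite /theta_hat -/hx.
apply: (HV hx th (ln m) (8 * rho) (hx 1)).
- exact: nondecreasing_measurable.
- move=> t /andP[t0 t1]; rewrite ger0_norm; first exact: hmono.
  by rewrite /hx /logp le_max lexx orbT.
- by rewrite mulr_ge0// ltW.
move=> t /andP[dt t1].
have t0 : 0 < t by exact: lt_le_trans dt.
have tth : delta `^ th <= t `^ th.
  by apply: ge0_ler_powR; rewrite ?nnegrE ?(ltW th0) ?(ltW d0) ?(ltW t0).
have nt0 : 0 <= n%:R * t by rewrite mulr_ge0// ltW.
rewrite /hx; set k := Num.truncn _.
have /andP[kt tk] : k%:R <= n%:R * t < k%:R + 1 by rewrite natr1; exact: truncn_itv.
have ndt : n%:R * delta <= n%:R * t by rewrite ler_wpM2l.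
have kd : n%:R * delta - 1 <= k%:R by lra.
have kn : (k <= n)%N by exact: truncn_mul_le.
have M0 : 0 < t `^ th * m by rewrite mulr_gt0// powR_gt0.
have ratio : 1 - 4 * rho <= (nb_words x k)%:R / (t `^ th * m) <= 1 + 4 * rho.
  apply: (@count_ratio _ th t m (expected_words th q k) _ C rho k n) => //.
  - by rewrite t0.
  - by rewrite r0.
  - by rewrite kt.
  - apply: (@le_trans _ _ (rho * (n%:R * delta))); last by rewrite ler_wpM2l// ltW.
    by rewrite mulrCA mulrC -ler_pdivrMl ?mulr_gt0// mulr1.
  - apply: le_trans (expected_words_lin h q1 kn n0) _; rewrite /C.
    by case/andP: qab; lra.
  - apply: (@le_trans _ _ (rho * (delta `^ th * (K1 * n%:R `^ th)))).
      by rewrite !mulrA mulrC -ler_pdivrMr// !mulr_gt0.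
    rewrite ler_wpM2l ?(ltW r0)//; apply: ler_pM => //; first exact: powR_ge0.
    by rewrite mulr_ge0 ?powR_ge0// ltW.
  - exact: close.
have Rk0 : 0 < (nb_words x k)%:R :> R.
  by case/andP: ratio; rewrite ler_pdivlMr// => r1 _; apply: lt_le_trans r1;
    rewrite mulr_gt0//; lra.
rewrite logp_nat -(ln_powR t th) -lnM ?posrE ?powR_gt0// -ln_div ?posrE//.
by apply: ler_norm_ln => //; rewrite ltW.
Unshelve. all: by end_near. Qed.

(** * The strong law for the number of different words, uniformly in q *)

Lemma power_bracket (M J k : nat) : (0 < M)%N -> (J ^ M <= k)%N ->
  exists2 j, (J <= j)%N & (j ^ M <= k < j.+1 ^ M)%N.
Proof.
move=> M0 Jk.
have ex : exists j, (j ^ M <= k)%N by exists J.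
have ub j : (j ^ M <= k)%N -> (j <= k)%N.
  by apply: leq_trans; case: j => // j; rewrite -[X in (X <= _)%N]expn1 leq_pexp2l.
case: (ex_maxnP ex ub) => j jk jmax; exists j; first exact: jmax.
rewrite jk ltnNge; apply/negP => /jmax.
by rewrite ltnn.
Qed.

(** Between two consecutive points of the subsequence the counts and their means
    are caught between the values at these points, and the means grow by at most
    the factor 1+r. *)
Lemma count_sandwich (R : realType) (mu : nat -> R) (x : nat -> nat) (r : R)
  (M J : nat) : (0 < M)%N -> 0 < r <= 8^-1 ->
  (forall k, 0 <= mu k) -> (forall k n, (k <= n)%N -> mu k <= mu n) ->
  (forall j, (J <= j)%N -> mu (j.+1 ^ M)%N <= (1 + r) * mu (j ^ M)%N) ->
  (forall j, (J <= j)%N ->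
     `|(nb_words x (j ^ M))%:R - mu (j ^ M)%N| <= r * mu (j ^ M)%N) ->
  forall k, (J ^ M <= k)%N -> `|(nb_words x k)%:R - mu k| <= 4 * r * mu k.
Proof.
move=> M0 /andP[r0 r8] mu0 mumono mug close k Jk.
have [j Jj /andP[jk kj]] := power_bracket M0 Jk.
have g := mug j Jj.
have := close j Jj; rewrite ler_distl => /andP[c1 _].
have := close j.+1 (leq_trans Jj (leqnSn j)); rewrite ler_distl => /andP[_ c2].
have R1 : (nb_words x (j ^ M))%:R <= (nb_words x k)%:R :> R.
  by rewrite ler_nat nb_words_mono.
have R2 : (nb_words x k)%:R <= (nb_words x (j.+1 ^ M))%:R :> R.
  by rewrite ler_nat nb_words_mono// ltnW.
have m1 := mumono _ _ jk; have m2 := mumono _ _ (ltnW kj).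
have := mu0 (j ^ M)%N; have := mu0 k.
move: (mu (j ^ M)%N) (mu (j.+1 ^ M)%N) (mu k) g c1 c2 m1 m2 => a b c g c1 c2 m1 m2 c0 a0.
have h1 : (1 + r) * b <= (1 + r) * ((1 + r) * a) by rewrite ler_wpM2l//; lra.
have h2 : r * (r * a) <= 8^-1 * (r * a) by rewrite ler_wpM2r// mulr_ge0// ltW.
have h3 : r * a <= r * c by rewrite ler_wpM2l// ltW.
have h4 : 0 <= r * a by rewrite mulr_ge0// ltW.
have h5 : (1 - 2 * r) * c <= (1 - 2 * r) * ((1 + r) * a).
  by rewrite ler_wpM2l//; lra.
rewrite ler_distl; apply/andP; split; lra.
Qed.

(** Telescoping, with 1/(y+1)^2 <= 1/y - 1/(y+1). *)
Lemma sum_inv_sq_le (R : realType) (J n : nat) : (0 < J)%N ->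
  series (fun i => ((J + i).+1%:R ^+ 2)^-1 : R) n <= J%:R^-1.
Proof.
move=> J0; suff : series (fun i => ((J + i).+1%:R ^+ 2)^-1 : R) n <=
    J%:R^-1 - (J + n)%:R^-1.
  by move/le_trans; apply; rewrite gerBl invr_ge0.
elim: n => [|n ih]; first by rewrite /series/= big_geq// addn0 subrr.
rewrite seriesSr addnS.
have j0 : 0 < (J + n)%:R :> R by rewrite ltr0n addn_gt0 J0.
suff : ((J + n).+1%:R ^+ 2)^-1 <= (J + n)%:R^-1 - (J + n).+1%:R^-1 :> R.
  by move=> H; apply: le_trans (lerD ih H) _; rewrite addrA subrK.
rewrite -natr1; set y := (J + n)%:R in j0 *.
have -> : y^-1 - (y + 1)^-1 = (y * (y + 1))^-1 by field; lra.
rewrite lef_pV2 ?posrE ?exprn_gt0 ?mulr_gt0 ?addr_gt0//.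
by rewrite expr2 ler_wpM2r//; lra.
Qed.

(** The exponent th < 1 only increases the ratio, and Bernoulli's inequality
    bounds (1 - 1/(j+1))^M. *)
Lemma pow_ratio_ge (R : realType) (th : R) (M j : nat) : 0 < th < 1 ->
  1 - M%:R / j.+1%:R <= ((j ^ M)%N%:R / (j.+1 ^ M)%N%:R) `^ th :> R.
Proof.
move=> /andP[th0 th1].
have [->|j0] := posnP j.
  case: M => [|M]; first by rewrite mul0r subr0 !expn0 divff ?oner_eq0// powR1.
  by rewrite exp0n// exp1n !divr1 powR0 ?gt_eqF// subr_le0 ler1n.
have p01 : 0 <= (j.+1%:R^-1 : R) <= 1 by rewrite invr_ge0 ler0n invf_le1 ?ltr0n// ler1n.
have := onem_expr_le M p01 => /andP[_ h].
have rE : (j ^ M)%N%:R / (j.+1 ^ M)%N%:R = (1 - j.+1%:R^-1) ^+ M :> R.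
  rewrite !natrX -expr_div_n; congr (_ ^+ _).
  by rewrite -natr1; field; rewrite natr1 pnatr_eq0.
have base0 : 0 < (j ^ M)%N%:R / (j.+1 ^ M)%N%:R :> R.
  by rewrite divr_gt0 ?ltr0n ?expn_gt0 ?j0.
apply: (@le_trans _ _ ((j ^ M)%N%:R / (j.+1 ^ M)%N%:R)).
  by rewrite rE lerBlDr addrC -lerBlDr.
apply: ger1_powR; last exact: ltW.
rewrite base0 ler_pdivrMr ?mul1r ?ltr0n ?expn_gt0// ler_nat.
by rewrite andTb; case: (M) => // M'; rewrite leq_exp2r.
Qed.

(** [expected_words_lin] with k = j^M and n = (j+1)^M: the ratio (k/n)^th tends
    to 1, and the constant error is negligible against r(k). *)
Lemma expected_words_growth (R : realType) (th a b r : R) (M : nat) :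
  0 < th < 1 -> -1 < a -> a <= b -> 0 < r <= 8^-1 -> (0 < M)%N ->
  \forall j \near \oo, forall q, a <= q <= b ->
    expected_words th q (j.+1 ^ M) <= (1 + r) * expected_words th q (j ^ M).
Proof.
move=> h a1 ab /andP[r0 r8] M0; have /andP[th0 th1] := h.
have [K1 K10 [N1 _ HK1]] := expected_words_ge_uniform h a1 ab.
pose C := 2 * b + 7.
have [N2 _ HN2] := near_powR_ge (C / (r / 4 * K1)) th0.
near=> j => q /[dup] qab /andP[aq qb].
have q1 : -1 < q by lra.
have jj : (j <= j ^ M)%N.
  by case: (j) => // i; rewrite -[X in (X <= _)%N]expn1 leq_pexp2l.
have j0 : (0 < j.+1 ^ M)%N by rewrite expn_gt0.
have jN1 : (N1 <= j ^ M)%N.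
  by apply: leq_trans jj; near: j; exact: nbhs_infty_ge.
have jN2 : (N2 <= j ^ M)%N.
  by apply: leq_trans jj; near: j; exact: nbhs_infty_ge.
have k1 := HK1 _ jN1 q qab; have k2 := HN2 _ jN2; rewrite /= in k1 k2.
have jle : (j ^ M <= j.+1 ^ M)%N by rewrite leq_exp2r.
have := expected_words_lin h q1 jle j0.
have v := @pow_ratio_ge R th M j h.
have jr : M%:R / j.+1%:R <= r / 4.
  rewrite ler_pdivrMr ?ltr0n// mulrC -ler_pdivrMr ?divr_gt0//.
  apply: (@le_trans _ _ j%:R); last by rewrite ler_nat.
  by near: j; exact: nbhs_infty_ger.
have Cr : C <= r / 4 * expected_words th q (j ^ M).
  move: k2; rewrite ler_pdivrMr ?mulr_gt0 ?divr_gt0// => k2.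
  apply: le_trans k2 _; rewrite [leLHS]mulrC -[leLHS]mulrA.
  by apply: ler_wpM2l k1; rewrite divr_ge0// ltW.
have mu0 : 0 <= expected_words th q (j.+1 ^ M).
  by rewrite -(expected_words0 th q); exact: expected_words_mono.
have mu1 : 0 <= expected_words th q (j ^ M).
  by rewrite -(expected_words0 th q); exact: expected_words_mono.
have qC : 2 * q + 7 <= C by rewrite /C; lra.
move: (expected_words _ _ _) (expected_words _ _ _) mu0 mu1 Cr => m m' m'0 m0 Cr.
move: v; set u := _ `^ _ => v; rewrite ler_distl => /andP[w _].
have v' : 1 - r / 4 <= u by apply: le_trans v; rewrite lerD2l lerN2.
have h1 : (1 - r / 4) * m' <= u * m' by rewrite ler_wpM2r.
have h2 : (1 - r / 4) * m' <= (1 + r / 4) * m by lra.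
have s0 : 0 < 1 - r / 4 by lra.
rewrite -(ler_pM2l s0) (le_trans h2)//.
have : r * (r * m) <= 8^-1 * (r * m) by rewrite ler_wpM2r// mulr_ge0// ltW.
have : 0 <= r * m by rewrite mulr_ge0// ltW.
lra.
Unshelve. all: by end_near. Qed.

(** Chebyshev's inequality along k = j^M, then [count_sandwich].  The number N
    and the bound on the exceptional event G depend on q only through the
    segment, because the means are bounded below by K1 k^th uniformly. *)
Lemma nb_words_strong_law (R : realType) (th a b rho eta : R) :
  0 < th < 1 -> -1 < a -> a <= b -> 0 < rho <= 8^-1 -> 0 < eta ->
  exists N : nat, forall (q : R) (d : measure_display) (T : measurableType d)
    (P : probability T R) (X : nat -> {RV P >-> nat}),
    a <= q <= b -> hypothesisH X th q ->
    exists G : set T, [/\ measurable G, (P G <= eta%:E)%E &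
      forall w, ~ G w -> forall k, (N <= k)%N ->
        `|(nb_words (fun j => X j w) k)%:R - expected_words th q k|
          <= rho * expected_words th q k].
Proof.
move=> h a1 ab /andP[rho0 rho8] eta0; have /andP[th0 th1] := h.
have [K1 K10 [N1 _ HK1]] := expected_words_ge_uniform h a1 ab.
(* With M th >= 2 the Chebyshev bound at j^M, of order 1 / (j^M)^th, is at most a
   multiple of 1/j^2. *)
pose M := (Num.truncn (2 / th)).+1.
have Mth : 2 <= M%:R * th.
  by rewrite -ler_pdivrMr// /M; exact/ltW/truncnS_gt.
have M0 : (0 < M)%N by [].
clearbody M.
(* [count_sandwich] loses a factor 4. *)
pose r := rho / 4.
have r0 : 0 < r by rewrite divr_gt0.
have r8 : 0 < r <= 8^-1 by rewrite r0 /r; lra.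
have [N2 _ HN2] := expected_words_growth h a1 ab r8 M0.
pose c := (r ^+ 2 * K1)^-1.
have c0 : 0 < c by rewrite invr_gt0 mulr_gt0// exprn_gt0.
(* c / J bounds the sum of the Chebyshev bounds c/j^2 over j > J. *)
pose J := (N1 + N2 + Num.truncn (c / eta)).+1.
have J0 : (0 < J)%N by [].
have Jc : c / J%:R <= eta.
  rewrite ler_pdivrMr ?ltr0n// mulrC -ler_pdivrMr//.
  apply: (@le_trans _ _ (Num.truncn (c / eta)).+1%:R); first exact/ltW/truncnS_gt.
  by rewrite ler_nat /J ltnS leq_addl.
have JN1 : (N1 <= J)%N by rewrite /J leqW// -addnA leq_addr.
have JN2 : (N2 <= J)%N by rewrite /J leqW// addnAC leq_addl.
clearbody J.
exists (J.+1 ^ M)%N => q d T P X qab H.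
have q1 : -1 < q by case/andP: qab => aq _; lra.
pose n i := ((J + i).+1 ^ M)%N.
pose mu k := expected_words th q k.
have jM i : (i <= i ^ M)%N.
  by case: i => // i; rewrite -[X in (X <= _)%N]expn1 leq_pexp2l.
have mupos k : 0 <= mu k.
  by rewrite -(expected_words0 th q); exact: expected_words_mono.
have muge i : K1 * (J + i).+1%:R ^+ 2 <= mu (n i).
  have N1n : (N1 <= n i)%N.
    rewrite /n; apply: leq_trans (jM _).
    by rewrite leqW// (leq_trans JN1)// leq_addr.
  apply: le_trans (HK1 _ N1n q qab); rewrite ler_wpM2l ?(ltW K10)//.
  rewrite -powR_mulrn// /n natrX -powR_mulrn// -powRrM.
  by apply: ler_powR => //; rewrite ler1n.
have munpos i : 0 < mu (n i).
  by apply: lt_le_trans (muge i); rewrite mulr_gt0// exprn_gt0// ltr0n.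
pose F i := [set w | r * mu (n i) <=
  `|(nb_words (fun j => X j w) (n i))%:R - expected_words th q (n i)|].
have mF i : measurable (F i).
  apply: (@measurable_prefix _ _ _ P X (fun x => r * mu (n i) <=
    `|(nb_words x (n i))%:R - expected_words th q (n i)|) (n i)).
  by move=> x y xy; rewrite (eq_nb_words xy).
have PF i : (P (F i) <= (c * ((J + i).+1%:R ^+ 2)^-1)%:E)%E.
  have t0 : 0 < r * mu (n i) by rewrite mulr_gt0.
  apply: le_trans (nb_words_chebyshev (n i) H t0) _.
  rewrite lee_fin -/(mu (n i)).
  have -> : mu (n i) / (r * mu (n i)) ^+ 2 = (r ^+ 2 * mu (n i))^-1.
    by field; rewrite !gt_eqF.
  rewrite /c -invfM lef_pV2 ?posrE ?mulr_gt0 ?exprn_gt0 ?ltr0n//.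
  by rewrite -mulrA ler_wpM2l// exprn_ge0// ltW.
exists (\bigcup_i F i); split.
- exact: bigcup_measurable.
- apply: le_trans (measure_sigma_subadditive P mF _ _) _ => //.
    exact: bigcup_measurable.
  apply: (@le_trans _ _ (\sum_(0 <= i <oo) (c * ((J + i).+1%:R ^+ 2)^-1)%:E)%E).
    by apply: lee_nneseries => i _ //; exact: PF.
  have pos i : 0 <= ((J + i).+1%:R ^+ 2)^-1 :> R by rewrite invr_ge0 exprn_ge0.
  have cs : cvgn (series (fun i => ((J + i).+1%:R ^+ 2)^-1 : R)).
    apply: is_cvg_series_ub pos _ => k; exact: sum_inv_sq_le.
  rewrite nneseries_EFin; last exact: is_cvg_seriesMl.
  rewrite lim_seriesMl// lee_fin; apply: le_trans Jc.
  rewrite ler_wpM2l ?(ltW c0)//; apply: lim_series_ub => // k.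
  exact: sum_inv_sq_le.
move=> w nG k Jk.
have -> : rho = 4 * r by rewrite /r mulrC divfK.
apply: (@count_sandwich R mu (fun j => X j w) r M J.+1) => //.
- by move=> i j ij; exact: expected_words_mono.
- move=> j Jj; apply: HN2 => //=.
  by apply: leq_trans Jj; rewrite leqW.
- move=> j Jj; apply/ltW; rewrite ltNge; apply/negP => Fj.
  apply: nG; exists (j - J.+1)%N => //.
  have nj : n (j - J.+1)%N = (j ^ M)%N by rewrite /n -addSn subnKC.
  by rewrite /F /= nj.
Qed.

(** * Dependence on finitely many words *)

Lemma eq_stieltjes01 (R : realType) (A f g : R -> R) :
  (forall t, 0 <= t <= 1 -> f t = g t) -> stieltjes01 A f = stieltjes01 A g.
Proof.
move=> fg; rewrite /stieltjes01; congr (_ + _).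
  by apply: eq_fsbigr => t; rewrite inE/= in_itv/= => t01; rewrite fg.
by apply: eq_Rintegral => t; rewrite inE/= in_itv/= => t01; rewrite fg.
Qed.

Lemma eq_theta_hat (R : realType) (A : R -> R) (x y : nat -> nat) (n : nat) :
  (forall k, (k <= n)%N -> nb_words x k = nb_words y k) ->
  theta_hat A x n = theta_hat A y n.
Proof.
move=> xy; apply: eq_stieltjes01 => t /andP[_ t1].
by rewrite xy//; exact: truncn_mul_le.
Qed.

Lemma eq_is_q_hat (R : realType) (A : R -> R) (x y : nat -> nat) (n : nat) (qh : R) :
  (forall k, (k <= n)%N -> nb_words x k = nb_words y k) ->
  is_q_hat A x n qh -> is_q_hat A y n qh.
Proof. by move=> xy [h1 h2 h3]; split; rewrite -?(eq_theta_hat A xy)// -xy. Qed.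

(** Only the values at 0, ..., n matter on [0,1]: at t = 1 the value at n+1 has
    weight zero. *)
Lemma eq_interpolation (R : realType) (n : nat) (f g : nat -> R) (t : R) :
  (forall k, (k <= n)%N -> f k = g k) -> 0 <= t <= 1 ->
  interpolation n f t = interpolation n g t.
Proof.
move=> fg /andP[t0 t1]; rewrite /interpolation.
have kn := truncn_mul_le n t1; set k := Num.truncn _ in kn *.
rewrite fg//; have [kn'|nk] := ltnP k n; first by rewrite fg.
have -> : n%:R * t - k%:R = 0; last by rewrite !mul0r.
have nt0 : 0 <= n%:R * t by rewrite mulr_ge0.
have /andP[kt _] := truncn_itv nt0.
apply/eqP; rewrite eq_le subr_le0 subr_ge0 kt andbT.
by apply: (@le_trans _ _ n%:R); [rewrite ler_piMr|rewrite ler_nat].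
Qed.

Lemma eq_Z_dist (R : realType) (A : R -> R) (x y : nat -> nat) (n : nat) (qh : R) :
  (forall k, (k <= n)%N -> nb_words x k = nb_words y k) ->
  unif_dist01 (Z_hat A x n) (Z_tilde A x n qh) =
  unif_dist01 (Z_hat A y n) (Z_tilde A y n qh).
Proof.
move=> xy; congr sup; apply: eq_imagel => t /=; rewrite in_itv/= => t01.
rewrite /Z_hat /Z_tilde (eq_theta_hat A xy).
congr `|_ - _|; apply: eq_interpolation => // k kn; by rewrite !xy.
Qed.

(** * Almost sure and uniform convergence *)

Definition good_text (R : realType) (A : R -> R) (eps : R) (n : nat)
  (x : nat -> nat) : Prop :=
  (exists qh, is_q_hat A x n qh) /\
  (forall qh, is_q_hat A x n qh ->
     unif_dist01 (Z_hat A x n) (Z_tilde A x n qh) <= eps).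

Lemma good_text_prefix (R : realType) (A : R -> R) (eps : R) (n : nat)
  (x y : nat -> nat) : (forall j, (j < n)%N -> x j = y j) ->
  good_text A eps n x -> good_text A eps n y.
Proof.
move=> xy.
have nxy k : (k <= n)%N -> nb_words x k = nb_words y k.
  by move=> kn; apply: eq_nb_words => j jk; apply: xy; exact: leq_trans jk kn.
have nyx k : (k <= n)%N -> nb_words y k = nb_words x k by move=> /nxy.
move=> [[qh hq] H]; split; first by exists qh; exact: eq_is_q_hat hq.
move=> q /(eq_is_q_hat nyx)/H; by rewrite (eq_Z_dist A _ nxy).
Qed.

Definition bad_event (R : realType) (d : measure_display) (T : measurableType d)
  (P : probability T R) (X : nat -> {RV P >-> nat}) (A : R -> R) (eps : R) (n : nat)
  : set T :=
  [set w | ~ forall m, (n <= m)%N -> good_text A eps m (fun j => X j w)].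

(** Being good is a condition on the first m words, hence measurable although it
    quantifies over all solutions of r(m) = R_m. *)
Lemma measurable_bad_event (R : realType) (d : measure_display)
  (T : measurableType d) (P : probability T R) (X : nat -> {RV P >-> nat})
  (A : R -> R) (eps : R) (n : nat) : measurable (bad_event X A eps n).
Proof.
have -> : bad_event X A eps n =
    ~` \bigcap_(m in [set m | (n <= m)%N]) [set w | good_text A eps m (fun j => X j w)].
  by apply/seteqP; split => w /=; apply: contra_not => H m nm; exact: H.
apply: measurableC; apply: bigcap_measurable; first by exists n => /=.
move=> m _; apply: (@measurable_prefix _ _ _ P X (good_text A eps m) m).
by move=> x y; exact: good_text_prefix.
Qed.

(** Outside the exceptional event of [nb_words_strong_law], whose probability is
    at most eta, all counts R_k with k >= m delta - 1 follow their means, which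
    makes the estimator of the exponent consistent and the text good. *)
Lemma bad_event_small (R : realType) (A : R -> R) (th a b eps eta : R) :
  admissible A -> -1 < a -> a <= b -> 0 < eps -> 0 < eta ->
  \forall n \near \oo,
    forall (q : R) (d : measure_display) (T : measurableType d)
      (P : probability T R) (X : nat -> {RV P >-> nat}),
    a <= q <= b -> hypothesisH X th q -> (P (bad_event X A eps n) <= eta%:E)%E.
Proof.
move=> hA a1 ab eps0 eta0.
have [h|nh] := boolP (0 < th < 1); last first.
  by apply: nearW => n q d T P X _ [h]; rewrite h in nh.
have /andP[th0 th1] := h.
have tau0 : 0 < th * (1 - th) / 8 by rewrite divr_gt0// mulr_gt0//; lra.
have [rho [delta [rho8 d01 [N1 _ HN1]]]] := theta_hat_consistent hA h a1 ab tau0.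
have [K1 K10 [N2 _ HN2]] := expected_words_ge_uniform h a1 ab.
(* R_m lies between 7/8 and 9/8 of its mean, which is at least K1 m^th and at
   most (2b+8) m^th. *)
have K20 : 0 < 4 * b + 20 by lra.
have K10' : 0 < K1 / 2 by rewrite divr_gt0.
have [N3 _ HN3] := good_of_counts A h K10' K20 eps0.
have [N4 HN4] := nb_words_strong_law h a1 ab rho8 eta0.
have /andP[d0 d1] := d01; have /andP[r0 r8] := rho8.
(* For m >= N5 the bound m delta - 1 <= k implies N4 <= k. *)
pose N5 := (Num.truncn ((N4%:R + 1) / delta)).+1.
have N5ge : (N4%:R + 1) / delta <= N5%:R by exact/ltW/truncnS_gt.
clearbody N5.
exists (N1 + N2 + N3 + N5).+1 => // n /= Nn q d T P X qab H.
have [G [mG PG HG]] := HN4 q d T P X qab H.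
apply: le_trans PG; apply: le_measure; rewrite ?inE//.
  exact: measurable_bad_event.
move=> w bad; apply: contrapT => /HG{}HG; apply: bad => m nm.
have q1 : -1 < q by case/andP: qab => aq _; lra.
have [m0 [N1m [N2m [N3m N5m]]]] :
    (0 < m)%N /\ (N1 <= m)%N /\ (N2 <= m)%N /\ (N3 <= m)%N /\ (N5 <= m)%N.
  by move: Nn nm; clear; lia.
have close k : m%:R * delta - 1 <= k%:R ->
   `|(nb_words (fun j => X j w) k)%:R - expected_words th q k|
          <= rho * expected_words th q k.
  move=> mk; apply: HG; rewrite -(ler_nat R); apply: le_trans mk.
  rewrite lerBrDr -ler_pdivrMr//.
  by apply: (le_trans N5ge); rewrite ler_nat.
have md : m%:R * delta - 1 <= m%:R.
  have : m%:R * delta <= m%:R by rewrite ler_piMr// ltW.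
  lra.
apply: (HN3 m N3m); last exact: (HN1 m N1m q).
have := close m md; rewrite ler_distl => /andP[c1 c2].
have k1 := HN2 m N2m q qab.
have k2 := expected_words_le_pow h q1 m0.
have mth : 0 < m%:R `^ th by rewrite powR_gt0// ltr0n.
have mu0 : 0 <= expected_words th q m by apply: le_trans k1; rewrite mulr_ge0 ?ltW.
move: c1 c2 k1 k2 mth mu0; move: (expected_words _ _ _) (nb_words _ _)%:R (m%:R `^ th).
move=> mu y z c1 c2 k1 k2 z0 mu0.
have h1 : rho * mu <= 8^-1 * mu by rewrite ler_wpM2r.
have h2 : (2 * q + 8) * z <= (2 * b + 8) * z.
  by rewrite ler_wpM2r ?(ltW z0)//; case/andP: qab => _ qb; lra.
have h3 : 0 <= (b + 1) * z by rewrite mulr_ge0 ?(ltW z0)//; lra.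
apply/andP; split; lra.
Qed.

(** The case of the segment reduced to q: the events decrease with n and their
    probabilities tend to 0. *)
Lemma bad_event_negligible (R : realType) (A : R -> R) (th q eps : R)
  (d : measure_display) (T : measurableType d)
  (P : probability T R) (X : nat -> {RV P >-> nat}) :
  admissible A -> hypothesisH X th q -> 0 < eps ->
  P.-negligible (\bigcap_n bad_event X A eps n).
Proof.
move=> hA H eps0; have q1 : -1 < q by case: H.
have mB n := measurable_bad_event X A eps n.
have mI : measurable (\bigcap_n bad_event X A eps n) by exact: bigcapT_measurable.
apply/negligibleP => //; apply/eqP; rewrite eq_le measure_ge0 andbT.
apply/lee_addgt0Pr => eta eta0; rewrite add0e.
have [N _ HN] := bad_event_small th hA q1 (lexx q) eps0 eta0.
have qq : q <= q <= q by rewrite lexx.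
apply: le_trans (HN N (leqnn N) q d T P X qq H).
by apply: le_measure; rewrite ?inE// => w; apply.
Qed.

Theorem theorem2p3 (R : realType) (A : R -> R) (theta : R) :
  admissible A ->
  (* almost surely, q_hat exists (for all large n), and the difference of the
     two processes tends to 0 uniformly on [0,1] *)
  (forall (q : R) (d : measure_display) (T : measurableType d)
      (P : probability T R) (X : nat -> {RV P >-> nat}),
    hypothesisH X theta q ->
    {ae P, forall w, \forall n \near \oo,
       exists qh, is_q_hat A (fun j => X j w) n qh} /\
    {ae P, forall w, forall qh : nat -> R,
       (\forall n \near \oo, is_q_hat A (fun j => X j w) n (qh n)) ->
       unif_dist01 (Z_hat A (fun j => X j w) n)
                   (Z_tilde A (fun j => X j w) n (qh n)) @[n --> \oo] --> 0})
  /\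
  (* the almost sure convergence is uniform in q in any segment [a,b]:
     sup_q P_q (not all m >= n are eps-good) tends to 0 as n tends to oo *)
  (forall a b : R, -1 < a -> a <= b ->
   forall eps eta : R, 0 < eps -> 0 < eta ->
   \forall n \near \oo,
     forall (q : R) (d : measure_display) (T : measurableType d)
       (P : probability T R) (X : nat -> {RV P >-> nat}),
     a <= q <= b -> hypothesisH X theta q ->
     (P [set w | (~ forall m, (n <= m)%N ->
           (exists qh, is_q_hat A (fun j => X j w) m qh) /\
           (forall qh, is_q_hat A (fun j => X j w) m qh ->
              unif_dist01 (Z_hat A (fun j => X j w) m)
                          (Z_tilde A (fun j => X j w) m qh) <= eps))%R]
        <= eta%:E)%E).
Proof.
move=> hA; split; last by move=> a b a1 ab eps eta eps0 eta0; exact: bad_event_small.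
move=> q d T P X H; split.
  apply: negligibleS (bad_event_negligible hA H ltr01) => w /= nw n _ good.
  apply: nw; exists n => // m /= nm.
  by have [] := good m nm.
have : P.-negligible (\bigcup_k \bigcap_n bad_event X A k.+1%:R^-1 n).
  by apply: negligible_bigcup => k; apply: bad_event_negligible H _; rewrite ?invr_gt0.
apply: negligibleS => w /= nw; apply: contrapT => nB; apply: nw => qh [N _ HN].
apply/cvgrPdist_le => e e0.
(* The tolerances 1/(k+1) are cofinal among the positive ones. *)
pose k := Num.truncn e^-1.
have [n good] : exists n, forall m, (n <= m)%N ->
    good_text A k.+1%:R^-1 m (fun j => X j w).
  apply: contrapT => ng; apply: nB; exists k => // n _ good; apply: ng.
  by exists n.
exists (maxn n N) => // m /=; rewrite geq_max => /andP[nm Nm].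
rewrite sub0r normrN ger0_norm ?unif_dist01_ge0//.
have [_ /(_ _ (HN m Nm))] := good m nm.
move/le_trans; apply.
by rewrite invf_ple ?posrE ?ltr0n//; exact/ltW/truncnS_gt.
Qed.
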